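(* Let $A$ be the Glaisher–Kinkelin constant and $\zeta$ the Riemann zeta function. Then $$\log A=\frac{\log 2}{12}+\frac1{36}\sum_{k=1}^{\infty}\big(\zeta(2k+1)-1\big)\Big(28+\frac{3}{1+k}-\frac{6}{2+k}\Big).$$
   Context: The Glaisher–Kinkelin constant $A>0$ is defined by $\log A=\frac1{12}-\zeta'(-1)$. *)

(* Defs.v *)
From Stdlib Require Import Reals.
From Coquelicot Require Import Coquelicot.

Open Scope R_scope.

Definition Cexp (z : C) : C :=
  (exp (Re z) * cos (Im z), exp (Re z) * sin (Im z)).

(* [n ^ s = exp (s log n)], with the real logarithm; only meant for [1 <= n]. *)
Definition nat_Cpow (n : nat) (s : C) : C :=
  Cexp (s * RtoC (ln (INR n)))%C.

(* The power series and its convergence are over [C], not over [R]. *)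
Definition analytic_at (f : C -> C) (z : C) : Prop :=
  exists (a : nat -> C) (r : R), 0 < r /\
    forall w : C, Cmod (w - z)%C < r ->
      @is_pseries C_AbsRing C_NormedModule a (w - z)%C (f w).

(* The Dirichlet series on [Re s > 1] together with its analytic continuation
   to [C \ {1}].  As [C \ {1}] is connected, this determines [zeta] everywhere
   except at the pole [1], where its value is left arbitrary. *)
Definition is_riemann_zeta (zeta : C -> C) : Prop :=
  (forall s : C, 1 < Re s ->
     @is_series C_AbsRing C_NormedModule
       (fun n : nat => nat_Cpow (S n) (- s)%C) (zeta s)) /\
  (forall s : C, s <> RtoC 1 -> analytic_at zeta s).

(* The equation is between complex numbers: [C_derive] is the complex
   derivative. *)
Definition is_glaisher_kinkelin (zeta : C -> C) (A : R) : Prop :=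
  0 < A /\
  RtoC (ln A) = (RtoC (1 / 12) - C_derive zeta (RtoC (-1)))%C.

(* Main.v *)
(** Euler-Maclaurin summation of [n^(-s)] up to its second Bernoulli correction
    gives, for [Re s > 1],
      [(1 - s) zeta(s) = em_start s + sum_(n >= 1) em_term n s],
    where [em_term n] is entire and [O(n^(-2))], uniformly on each unit disc centred
    in [Re s >= -1].  With [y = ln (1 + 1/n)], the correction is
    [n^(1-s) sum_j em_coef j s y^j / j!], and [em_coef j] vanishes for [j < 5];
    bounding absolute sums of Taylor coefficients makes the sum over [n] analytic
    without any Cauchy theory.  The identity theorem on a ray from [-1] to
    [Re s > 1] that avoids the pole then transports the formula to [-1], and
    differentiating there expresses [ln A] as a real series.  On the other side,
    exchanging the sums over [k] and [n] in the statement turns the right-hand side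
    into a series of logarithms, which summation by parts compares with the former. *)

Require Import Defs.
From Stdlib Require Import Reals Lra Lia Psatz Classical Factorial IndefiniteDescription.
From Coquelicot Require Import Coquelicot.

Open Scope R_scope.

(** * Series of complex numbers *)

(** The hypothesis on [zeta] gives no formula at -1, only power series of unknown radius, so
    everything known there is carried over from the right of the plane. The point -1 dictates the
    order of the correction: the unit disc around it reaches [Re s = -2], where [n^(1-s)] has size
    [n^3]. The trapezoidal rule alone would leave a relative error [n^(-3)], which is not summable
    against [n^3]; the next correction leaves [n^(-5)]. The factor [1 - s] clears the denominator of
    the integral term [n^(1-s) / (1 - s)] and so keeps every term entire. Two Taylor coefficients at
    -1 are then read off: the constant one gives [zeta(-1) = -1/12], the linear one gives
    [zeta'(-1)]. On the side of the statement, summing over [k] for a fixed [n] turns the weights 3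
    and -6 into [3 n - 6 n^3] times [- ln (1 - 1/n^2)], up to the polynomial part [6 n], and the
    weight 28 into the telescoping [28 / (n (n^2 - 1))]. *)

Definition Cser (a : nat -> C) (l : C) : Prop := @is_series C_AbsRing C_NormedModule a l.
Notation Csum_n := (@sum_n C_AbelianMonoid).

Lemma Cser_Cmod (a : nat -> C) (l : C) :
  Cser a l <-> is_lim_seq (fun n => Cmod (Csum_n a n - l)%C) 0.
Proof.
  unfold Cser, is_series. split.
  - intros H. apply is_lim_seq_spec. intros eps.
    pose proof (proj1 (filterlim_locally_ball_norm (K:=C_AbsRing) (U:=C_NormedModule) _ _) H eps) as H1.
    revert H1. apply filter_imp. intros n Hn.
    rewrite Rminus_0_r, Rabs_pos_eq by apply Cmod_ge_0. exact Hn.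
  - intros H. apply is_lim_seq_spec in H.
    apply (proj2 (filterlim_locally_ball_norm (K:=C_AbsRing) (U:=C_NormedModule) _ _)). intros eps.
    generalize (H eps). apply filter_imp. intros n Hn.
    rewrite Rminus_0_r, Rabs_pos_eq in Hn by apply Cmod_ge_0. exact Hn.
Qed.

Lemma Csum_n_S (a : nat -> C) n : Csum_n a (S n) = (Csum_n a n + a (S n))%C :> C.
Proof. rewrite sum_Sn. reflexivity. Qed.

Lemma Rsum_n_S (a : nat -> R) n : sum_n a (S n) = sum_n a n + a (S n) :> R.
Proof. rewrite sum_Sn. reflexivity. Qed.

Lemma Re_Csum_n (a : nat -> C) n : Re (Csum_n a n) = sum_n (fun k => Re (a k)) n.
Proof. induction n. now rewrite !sum_O. rewrite Csum_n_S, Rsum_n_S, re_plus, IHn. reflexivity. Qed.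

Lemma Im_Csum_n (a : nat -> C) n : Im (Csum_n a n) = sum_n (fun k => Im (a k)) n.
Proof. induction n. now rewrite !sum_O. rewrite Csum_n_S, Rsum_n_S, im_plus, IHn. reflexivity. Qed.

Lemma Cmod_le_Re_Im (z : C) : Cmod z <= Rabs (Re z) + Rabs (Im z).
Proof.
  replace z with (RtoC (Re z) + Ci * RtoC (Im z))%C at 1.
  - eapply Rle_trans. apply Cmod_triangle. rewrite Cmod_mult, Cmod_Ci, !Cmod_R. lra.
  - destruct z as [x y]. unfold Ci, RtoC, Cplus, Cmult, Re, Im. simpl. f_equal; ring.
Qed.

Lemma im_le_Cmod (z : C) : Rabs (Im z) <= Cmod z.
Proof. eapply Rle_trans; [| apply Rmax_Cmod]. apply Rmax_r. Qed.

Lemma Cser_Re_Im (a : nat -> C) (l : C) :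
  Cser a l <-> is_series (fun n => Re (a n)) (Re l) /\ is_series (fun n => Im (a n)) (Im l).
Proof.
  rewrite Cser_Cmod. split.
  - intros H. split.
    + change (is_lim_seq (sum_n (fun n => Re (a n))) (Re l)).
      apply (is_lim_seq_ext (fun n => (Re (Csum_n a n - l)%C) + Re l)).
      * intros n. unfold Cminus. rewrite re_plus, re_opp, Re_Csum_n. ring.
      * replace (Finite (Re l)) with (Rbar_plus 0 (Re l)) by (simpl; f_equal; ring).
        apply is_lim_seq_plus'; [|apply is_lim_seq_const].
        apply is_lim_seq_abs_0. apply (is_lim_seq_le_le (fun _ => 0) _ (fun n => Cmod (Csum_n a n - l)%C)); auto.
        intros n. split. apply Rabs_pos. apply re_le_Cmod. apply is_lim_seq_const.
    + change (is_lim_seq (sum_n (fun n => Im (a n))) (Im l)).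
      apply (is_lim_seq_ext (fun n => (Im (Csum_n a n - l)%C) + Im l)).
      * intros n. unfold Cminus. rewrite im_plus, im_opp, Im_Csum_n. ring.
      * replace (Finite (Im l)) with (Rbar_plus 0 (Im l)) by (simpl; f_equal; ring).
        apply is_lim_seq_plus'; [|apply is_lim_seq_const].
        apply is_lim_seq_abs_0. apply (is_lim_seq_le_le (fun _ => 0) _ (fun n => Cmod (Csum_n a n - l)%C)); auto.
        intros n. split. apply Rabs_pos. apply im_le_Cmod. apply is_lim_seq_const.
  - intros [H1 H2].
    apply (is_lim_seq_le_le (fun _ => 0) _
      (fun n => Rabs (sum_n (fun n => Re (a n)) n - Re l) + Rabs (sum_n (fun n => Im (a n)) n - Im l))).
    + intros n. split. apply Cmod_ge_0.
      rewrite <- Re_Csum_n, <- Im_Csum_n. eapply Rle_trans. apply Cmod_le_Re_Im.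
      unfold Cminus. rewrite re_plus, re_opp, im_plus, im_opp. apply Rle_refl.
    + apply is_lim_seq_const.
    + replace (Finite 0) with (Rbar_plus 0 0) by (simpl; f_equal; ring).
      apply is_lim_seq_plus'; apply -> is_lim_seq_abs_0.
      * replace (Finite 0) with (Finite (Re l - Re l)) by (f_equal; ring).
        apply is_lim_seq_minus'; [exact H1|apply is_lim_seq_const].
      * replace (Finite 0) with (Finite (Im l - Im l)) by (f_equal; ring).
        apply is_lim_seq_minus'; [exact H2|apply is_lim_seq_const].
Qed.

Lemma Cser_unique (a : nat -> C) (l1 l2 : C) : Cser a l1 -> Cser a l2 -> l1 = l2.
Proof.
  rewrite !Cser_Re_Im. intros [H1 H2] [H3 H4].
  apply is_series_unique in H1, H2, H3, H4.
  destruct l1, l2; simpl in *. f_equal; congruence.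
Qed.

Lemma Cser_ext (a b : nat -> C) (l : C) : (forall n, a n = b n) -> Cser a l -> Cser b l.
Proof. intros H. apply is_series_ext. exact H. Qed.

Lemma Cser_plus (a b : nat -> C) (la lb : C) :
  Cser a la -> Cser b lb -> Cser (fun n => a n + b n)%C (la + lb)%C.
Proof. exact (is_series_plus (K:=C_AbsRing) (V:=C_NormedModule) a b la lb). Qed.

Lemma Cser_scal (c : C) (a : nat -> C) (l : C) :
  Cser a l -> Cser (fun n => c * a n)%C (c * l)%C.
Proof. exact (is_series_scal (K:=C_AbsRing) (V:=C_NormedModule) c a l). Qed.

Lemma Cser_RtoC (a : nat -> R) (l : R) :
  is_series a l <-> Cser (fun n => RtoC (a n)) (RtoC l).
Proof.
  rewrite Cser_Re_Im. simpl. split.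
  - intros H. split; auto. change (is_lim_seq (sum_n (fun _ => 0)) 0). apply (is_lim_seq_ext (fun _ => 0)).
    + intros n. symmetry. rewrite sum_n_const. ring.
    + apply is_lim_seq_const.
  - tauto.
Qed.

Lemma Cmod_Csum_n (a : nat -> C) n : Cmod (Csum_n a n) <= sum_n (fun k => Cmod (a k)) n.
Proof.
  induction n. rewrite !sum_O. lra.
  rewrite Csum_n_S, Rsum_n_S. eapply Rle_trans. apply Cmod_triangle. lra.
Qed.

Lemma is_lim_seq_Cmod_bound (u : nat -> C) (l : C) (M : R) :
  is_lim_seq (fun n => Cmod (u n - l)%C) 0 -> (forall n, Cmod (u n) <= M) -> Cmod l <= M.
Proof.
  intros H HM.
  apply (is_lim_seq_le (fun _ => Cmod l) (fun n => Cmod (u n - l)%C + M) (Cmod l) M).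
  - intros n. replace l with ((u n) - (u n - l))%C at 1 by ring.
    unfold Cminus at 1. eapply Rle_trans. apply Cmod_triangle. rewrite Cmod_opp. specialize (HM n). lra.
  - apply is_lim_seq_const.
  - replace (Finite M) with (Finite (0 + M)) by (f_equal; ring).
    apply is_lim_seq_plus'; [exact H|apply is_lim_seq_const].
Qed.

Lemma Cmod_Cser_le (a : nat -> C) (l : C) (M : R) :
  Cser a l -> (forall n, sum_n (fun k => Cmod (a k)) n <= M) -> Cmod l <= M.
Proof.
  intros H HM. apply Cser_Cmod in H.
  apply (is_lim_seq_Cmod_bound (Csum_n a)); auto.
  intros n. eapply Rle_trans. apply Cmod_Csum_n. apply HM.
Qed.

Lemma Cser_ex_abs (a : nat -> C) (M : nat -> R) :
  (forall n, Cmod (a n) <= M n) -> ex_series M -> exists l, Cser a l.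
Proof.
  intros H HM.
  assert (H1 : ex_series (fun n => Re (a n))).
  { apply (ex_series_le (K:=R_AbsRing) (V:=R_CompleteNormedModule) _ M); auto.
    intros n. eapply Rle_trans. apply re_le_Cmod. apply H. }
  assert (H2 : ex_series (fun n => Im (a n))).
  { apply (ex_series_le (K:=R_AbsRing) (V:=R_CompleteNormedModule) _ M); auto.
    intros n. eapply Rle_trans. apply im_le_Cmod. apply H. }
  destruct H1 as [x Hx], H2 as [y Hy]. exists (x, y).
  apply Cser_Re_Im. split; assumption.
Qed.

Lemma nonneg_series_bounded (a : nat -> R) (M : R) :
  (forall n, 0 <= a n) -> (forall n, sum_n a n <= M) ->
  exists l, is_series a l /\ l <= M.
Proof.
  intros Ha HM.
  assert (Hi : forall n, sum_n a n <= sum_n a (S n)) by (intros n; rewrite Rsum_n_S; specialize (Ha (S n)); lra).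
  destruct (ex_finite_lim_seq_incr _ M Hi HM) as [l Hl].
  exists l. split. exact Hl.
  apply (is_lim_seq_le _ (fun _ => M) l M HM Hl). apply is_lim_seq_const.
Qed.

Lemma sum_n_le_loc_nonneg (a : nat -> R) (l : R) n :
  (forall n, 0 <= a n) -> is_series a l -> sum_n a n <= l.
Proof.
  intros Ha Hl. apply (is_lim_seq_incr_compare (sum_n a) l Hl).
  intros k; rewrite Rsum_n_S; specialize (Ha (S k)); lra.
Qed.

Lemma is_lim_seq_sum_n_0 (g : nat -> nat -> R) (N : nat) :
  (forall n, is_lim_seq (g n) 0) -> is_lim_seq (fun K => sum_n (fun n => g n K) N) 0.
Proof.
  intros H. induction N.
  - apply (is_lim_seq_ext (g O)); auto. intros K. now rewrite sum_O.
  - apply (is_lim_seq_ext (fun K => sum_n (fun n => g n K) N + g (S N) K)).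
    + intros K. now rewrite Rsum_n_S.
    + replace (Finite 0) with (Finite (0 + 0)) by (f_equal; ring). apply is_lim_seq_plus'; auto.
Qed.

Lemma sum_n_split (a : nat -> R) n m : sum_n a (S n + m) = sum_n a n + sum_n (fun k => a (S n + k)%nat) m :> R.
Proof.
  induction m. rewrite Nat.add_0_r, sum_O, Rsum_n_S, Nat.add_0_r. reflexivity.
  replace (S n + S m)%nat with (S (S n + m)) by lia. rewrite (Rsum_n_S _ (S n + m)), (Rsum_n_S _ m), IHm.
  replace (S n + S m)%nat with (S (S n + m)) by lia. ring.
Qed.

(** Dominated convergence for series: beyond [N0] the terms are controlled by the tail of [M],
    uniformly in [K], and the finitely many terms before it tend to 0 with [K]. *)
Lemma tannery (g : nat -> nat -> C) (M : nat -> R) (T : nat -> C) :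
  (forall N K, Cmod (g N K) <= M N) -> ex_series M ->
  (forall N, is_lim_seq (fun K => Cmod (g N K)) 0) ->
  (forall K, Cser (fun N => g N K) (T K)) ->
  is_lim_seq (fun K => Cmod (T K)) 0.
Proof.
  intros Hg [m Hm] Hlim HT.
  assert (HM0 : forall N, 0 <= M N) by (intros N; eapply Rle_trans; [apply Cmod_ge_0 | apply (Hg N O)]).
  apply is_lim_seq_spec. intros eps.
  assert (Hm2 : is_lim_seq (sum_n M) m) by exact Hm. apply is_lim_seq_spec in Hm2.
  assert (He : 0 < eps / 2) by (destruct eps; simpl; lra).
  destruct (Hm2 (mkposreal _ He)) as [N0 HN0]. simpl in HN0.
  pose proof (is_lim_seq_sum_n_0 (fun N K => Cmod (g N K)) N0 Hlim) as H0.
  apply is_lim_seq_spec in H0. generalize (H0 (mkposreal _ He)). apply filter_imp. simpl.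
  intros K HK. rewrite Rminus_0_r in *.
  rewrite Rabs_pos_eq by apply Cmod_ge_0.
  apply Rle_lt_trans with (sum_n (fun n => Cmod (g n K)) N0 + (m - sum_n M N0)).
  - apply (Cmod_Cser_le _ _ _ (HT K)). intros n.
    assert (Hs : forall p, sum_n (fun k => Cmod (g (S N0 + k)%nat K)) p <= m - sum_n M N0).
    { intros p. apply Rle_trans with (sum_n (fun k => M (S N0 + k)%nat) p).
      apply sum_n_m_le. intros k. apply Hg.
      pose proof (sum_n_split M N0 p). pose proof (sum_n_le_loc_nonneg M m (S N0 + p) HM0 Hm). lra. }
    destruct (Compare_dec.le_lt_dec n N0) as [Hn|Hn].
    + apply Rle_trans with (sum_n (fun k : nat => Cmod (g k K)) N0).
      * replace N0 with (n + (N0 - n))%nat by lia. generalize (N0 - n)%nat. intros q. induction q.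
        rewrite Nat.add_0_r. lra. rewrite Nat.add_succ_r, Rsum_n_S. pose proof (Cmod_ge_0 (g (S (n + q)) K)). lra.
      * pose proof (sum_n_le_loc_nonneg M m N0 HM0 Hm). lra.
    + replace n with (S N0 + (n - S N0))%nat by lia. rewrite sum_n_split. specialize (Hs (n - S N0)%nat). lra.
  - specialize (HN0 N0 (Nat.le_refl _)). rewrite Rabs_minus_sym in HN0.
    pose proof (Rle_abs (m - sum_n M N0)). pose proof (Rle_abs (sum_n (fun n : nat => Cmod (g n K)) N0)). lra.
Qed.

Lemma Cser_sum_n (c : nat -> nat -> C) (b : nat -> C) (K : nat) :
  (forall k, Cser (fun N => c N k) (b k)) -> Cser (fun N => Csum_n (c N) K) (Csum_n b K).
Proof.
  intros H. induction K.
  - rewrite sum_O. apply (Cser_ext (fun N => c N O)); auto. intros n; now rewrite sum_O.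
  - rewrite Csum_n_S. apply (Cser_ext (fun N => Csum_n (c N) K + c N (S K))%C).
    intros n; now rewrite Csum_n_S. now apply Cser_plus.
Qed.

(** Dominated convergence is applied to the row remainders [sum_(k <= K) c N k - f N]. Each is at
    most [2 * M N], and their sum over [N] is the remainder of the series of [b] at [K]. *)
Lemma Cser_fubini (c : nat -> nat -> C) (M : nat -> R) (b f : nat -> C) (F : C) :
  (forall N K, sum_n (fun k => Cmod (c N k)) K <= M N) -> ex_series M ->
  (forall N, Cser (c N) (f N)) -> (forall k, Cser (fun N => c N k) (b k)) ->
  Cser f F -> Cser b F.
Proof.
  intros Hc HM Hf Hb HF. apply Cser_Cmod.
  apply (tannery (fun N K => Csum_n (c N) K - f N)%C (fun N => 2 * M N)).
  - intros N K. unfold Cminus. eapply Rle_trans. apply Cmod_triangle. rewrite Cmod_opp.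
    pose proof (Cmod_Cser_le _ _ _ (Hf N) (Hc N)).
    pose proof (Cmod_Csum_n (c N) K). pose proof (Hc N K). lra.
  - destruct HM as [m Hm]. exists (2 * m). now apply (is_series_scal 2 M m).
  - intros N. apply Cser_Cmod. apply Hf.
  - intros K. unfold Cminus. apply Cser_plus. now apply Cser_sum_n.
    apply (Cser_ext (fun n => (-(1)) * f n)%C). intros n; ring.
    replace (- F)%C with (-(1) * F)%C by ring. now apply Cser_scal.
Qed.

Lemma Cser_incr_1 (a : nat -> C) (l : C) : Cser a l -> Cser (fun k => a (S k)) (l - a O)%C.
Proof.
  intros H. apply (is_series_incr_1 (K:=C_AbsRing) (V:=C_NormedModule)).
  change (Cser a ((l - a O) + a O)%C). replace ((l - a O) + a O)%C with l by ring. exact H.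
Qed.

Lemma Cser_decr_1 (a : nat -> C) (l : C) : Cser (fun k => a (S k)) (l - a O)%C -> Cser a l.
Proof. exact (is_series_decr_1 (K:=C_AbsRing) (V:=C_NormedModule) a l). Qed.

Lemma Cser_terms_bounded (a : nat -> C) (l : C) :
  Cser a l -> exists B, 0 <= B /\ forall k, Cmod (a k) <= B.
Proof.
  intros H. apply Cser_Re_Im in H. destruct H as [H1 H2].
  assert (X1 : ex_series (fun n => Re (a n))) by (eexists; exact H1).
  assert (X2 : ex_series (fun n => Im (a n))) by (eexists; exact H2).
  apply ex_series_lim_0 in X1. apply ex_series_lim_0 in X2.
  assert (Y : forall u : nat -> R, is_lim_seq u 0 -> exists B, 0 <= B /\ forall k, Rabs (u k) <= B).
  { intros u Hu.
    assert (Hb : exists B, forall n, Rabs (u n) <= B).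
    { apply is_lim_seq_Reals in Hu.
      destruct (maj_by_pos u (exist _ 0 Hu)) as [B [_ HB]]. exists B. exact HB. }
    destruct Hb as [B HB]. exists B. split; auto. eapply Rle_trans; [apply Rabs_pos | apply (HB O)]. }
  destruct (Y _ X1) as [B1 [? HB1]]. destruct (Y _ X2) as [B2 [? HB2]].
  exists (B1 + B2). split. lra. intros k. eapply Rle_trans. apply Cmod_le_Re_Im.
  specialize (HB1 k). specialize (HB2 k). simpl in *. lra.
Qed.

(** * Complex power series and the identity theorem *)

(* Abel's estimate: convergence at the single point [w0] controls the remainder on half the disc. *)
Lemma Cpseries_remainder2 (a : nat -> C) (w0 l0 : C) :
  w0 <> 0 -> Cser (fun k => a k * w0 ^ k)%C l0 ->
  exists B, 0 <= B /\ forall w l, Cmod w <= Cmod w0 / 2 -> Cser (fun k => a k * w ^ k)%C l ->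
    Cmod (l - a O - a 1%nat * w)%C <= B * (Cmod w) ^ 2.
Proof.
  intros Hw0 H. destruct (Cser_terms_bounded _ _ H) as [B [HB0 HB]].
  assert (Hp : 0 < Cmod w0) by now apply Cmod_gt_0.
  assert (Hp2 : 0 < (Cmod w0) ^ 2) by (apply pow_lt; auto).
  exists (2 * B / (Cmod w0) ^ 2). split.
  { apply Rmult_le_pos. lra. left. now apply Rinv_0_lt_compat. }
  intros w l Hw Hl.
  apply Cser_incr_1 in Hl. apply Cser_incr_1 in Hl.
  replace (l - a 0%nat - a 1%nat * w)%C with (l - a 0%nat * w ^ 0 - a 1%nat * w ^ 1)%C by (simpl; ring).
  apply (Cmod_Cser_le _ _ _ Hl).
  assert (Hq : 0 <= Cmod w / Cmod w0 <= 1 / 2).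
  { split. apply Rmult_le_pos. apply Cmod_ge_0. left; now apply Rinv_0_lt_compat.
    apply (Rmult_le_reg_r (Cmod w0)); auto. field_simplify; lra. }
  assert (Ht : forall k, Cmod (a (S (S k)) * w ^ S (S k))%C <= (B / (Cmod w0) ^ 2 * (Cmod w) ^ 2) * (1 / 2) ^ k).
  { intros k. rewrite Cmod_mult, Cmod_pow.
    pose proof (HB (S (S k))) as Hk. rewrite Cmod_mult, Cmod_pow in Hk.
    replace (Cmod w ^ S (S k)) with (Cmod w0 ^ S (S k) * ((Cmod w / Cmod w0) ^ S (S k))).
    2:{ rewrite <- Rpow_mult_distr. f_equal. field. lra. }
    rewrite <- Rmult_assoc.
    apply Rle_trans with (B * (Cmod w / Cmod w0) ^ S (S k)).
    apply Rmult_le_compat_r; auto. apply pow_le; lra.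
    replace (B / (Cmod w0) ^ 2 * (Cmod w) ^ 2 * (1 / 2) ^ k) with (B * ((Cmod w / Cmod w0)^2 * (1/2)^k)) by (field; lra).
    apply Rmult_le_compat_l; auto.
    change (S (S k)) with (2 + k)%nat. rewrite pow_add. apply Rmult_le_compat_l. apply pow_le; lra.
    apply pow_incr. lra. }
  intros n.
  apply Rle_trans with (sum_n (fun k => (B / (Cmod w0) ^ 2 * (Cmod w) ^ 2) * (1 / 2) ^ k) n).
  apply sum_n_m_le. exact Ht.
  apply sum_n_le_loc_nonneg.
  - intros k. apply Rmult_le_pos. apply Rmult_le_pos. apply Rmult_le_pos; auto. left; now apply Rinv_0_lt_compat.
    apply pow2_ge_0. apply pow_le; lra.
  - replace (2 * B / Cmod w0 ^ 2 * Cmod w ^ 2) with ((B / Cmod w0 ^ 2 * Cmod w ^ 2) * / (1 - 1 / 2)) by (field; lra).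
    apply (is_series_scal (B / Cmod w0 ^ 2 * Cmod w ^ 2) (fun k => (1/2)^k)).
    apply is_series_geom. rewrite Rabs_pos_eq; lra.
Qed.

Lemma Cmod_RtoC_pos (t : R) : 0 <= t -> Cmod (RtoC t) = t.
Proof. intros H. rewrite Cmod_R. now apply Rabs_pos_eq. Qed.

Lemma RtoC_neq_0 (t : R) : t <> 0 -> RtoC t <> 0.
Proof. intros H E. apply H. now apply RtoC_inj. Qed.

Lemma le_epsilon_linear (x B r : R) : 0 < r -> 0 <= B -> (forall t, 0 < t < r -> x <= B * t) -> x <= 0.
Proof.
  intros Hr HB H. destruct (Rle_lt_dec x 0) as [|Hx]; auto. exfalso.
  pose (t := Rmin (r / 2) (x / (2 * (B + 1)))).
  assert (0 < x / (2 * (B + 1))) by (apply Rdiv_lt_0_compat; lra).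
  assert (Ht : 0 < t < r).
  { unfold t. split. apply Rmin_glb_lt; lra. pose proof (Rmin_l (r/2) (x / (2 * (B + 1)))). lra. }
  specialize (H t Ht).
  assert (t <= x / (2 * (B + 1))) by apply Rmin_r.
  assert (B * t <= (B + 1) * (x / (2 * (B + 1)))) by nra.
  replace ((B + 1) * (x / (2 * (B + 1)))) with (x / 2) in H2 by (field; lra). lra.
Qed.

(** As [t] tends to 0 from the right, the linear term and the quadratic remainder are both [O(t)],
    which bounds the constant coefficient by a multiple of every small [t]. *)
Lemma Cpseries_coef0 (a : nat -> C) (r : R) : 0 < r ->
  (forall t, 0 < t < r -> Cser (fun k => a k * RtoC t ^ k)%C 0) -> a O = 0.
Proof.
  intros Hr H. apply Cmod_eq_0. apply Rle_antisym; [|apply Cmod_ge_0].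
  assert (H0 : RtoC (r / 2) <> 0) by (apply RtoC_neq_0; lra).
  destruct (Cpseries_remainder2 a (RtoC (r/2)) 0 H0) as [B [HB0 HB]]. apply H; lra.
  apply (le_epsilon_linear _ (B * r + Cmod (a 1%nat)) (r / 4)). lra.
  { pose proof (Cmod_ge_0 (a 1%nat)). nra. }
  intros t Ht.
  assert (Ht2 : Cmod (RtoC t) = t) by (apply Cmod_RtoC_pos; lra).
  specialize (HB (RtoC t) 0).
  rewrite Ht2, (Cmod_RtoC_pos (r/2)) in HB by lra.
  assert (Cmod (0 - a 0%nat - a 1%nat * t)%C <= B * t ^ 2)  by (apply HB; [lra | apply H; lra]).
  replace (a 0%nat) with (-((0 - a 0%nat - a 1%nat * t) + a 1%nat * t))%C by ring.
  rewrite Cmod_opp. eapply Rle_trans. apply Cmod_triangle. rewrite Cmod_mult, Ht2.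
  assert (B * t ^ 2 <= B * r * t) by (replace (B * t ^ 2) with (B * t * t) by ring; apply Rmult_le_compat_r; nra).
  lra.
Qed.

(** Once the constant coefficient is 0, division by [t] shifts the series by one place; the
    induction therefore generalises over [a]. *)
Lemma Cpseries_zero (a : nat -> C) (r : R) : 0 < r ->
  (forall t, 0 < t < r -> Cser (fun k => a k * RtoC t ^ k)%C 0) -> forall k, a k = 0.
Proof.
  intros Hr H k. revert a H. induction k; intros a H.
  - now apply (Cpseries_coef0 a r).
  - apply (IHk (fun k => a (S k))). intros t Ht.
    pose proof (Cpseries_coef0 a r Hr H) as H0.
    pose proof (Cser_incr_1 _ _ (H t Ht)) as H1. simpl in H1. rewrite H0 in H1.
    apply (Cser_scal (/ RtoC t)%C) in H1.
    replace (/ t * (0 - 0 * 1))%C with (RtoC 0) in H1 by ring.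
    eapply Cser_ext; [| exact H1]. intros n. simpl. field. apply RtoC_neq_0. lra.
Qed.

Lemma is_pseries_C (a : nat -> C) (w l : C) :
  @is_pseries C_AbsRing C_NormedModule a w l <-> Cser (fun k => a k * w ^ k)%C l.
Proof.
  assert (E : forall k, scal (V:=C_NormedModule) (pow_n (K:=C_AbsRing) w k) (a k) = (a k * w ^ k)%C).
  { intros k. transitivity (@pow_n C_AbsRing w k * a k)%C; [reflexivity|].
    rewrite Cmult_comm. reflexivity. }
  unfold Cser, is_pseries. split; apply is_series_ext; intros k; [|symmetry]; apply E.
Qed.

(* [has_Cpseries f z a r]: [f (z + w) = sum_k a_k w^k] for [|w| < r]. *)
Definition has_Cpseries (f : C -> C) (z : C) (a : nat -> C) (r : R) : Prop :=
  0 < r /\ forall w : C, Cmod w < r -> Cser (fun k => a k * w ^ k)%C (f (z + w)%C).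

Lemma analytic_at_has_Cpseries (f : C -> C) (z : C) :
  analytic_at f z <-> exists a r, has_Cpseries f z a r.
Proof.
  split; intros [a [r [Hr H]]]; exists a, r; split; auto.
  - intros w Hw. specialize (H (z + w)%C). replace ((z + w) - z)%C with w in H by ring.
    now apply is_pseries_C, H.
  - intros w Hw. specialize (H (w - z)%C Hw). replace (z + (w - z))%C with w in H by ring.
    now apply is_pseries_C.
Qed.

Lemma has_Cpseries_minus f g z a b r1 r2 :
  has_Cpseries f z a r1 -> has_Cpseries g z b r2 ->
  has_Cpseries (fun s => f s - g s)%C z (fun k => a k - b k)%C (Rmin r1 r2).
Proof.
  intros [H1 Ha] [H2 Hb]. split. now apply Rmin_glb_lt.
  intros w Hw.
  pose proof (Ha w (Rlt_le_trans _ _ _ Hw (Rmin_l _ _))) as Ea.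
  pose proof (Hb w (Rlt_le_trans _ _ _ Hw (Rmin_r _ _))) as Eb.
  apply (Cser_scal (-(1))%C) in Eb. pose proof (Cser_plus _ _ _ _ Ea Eb) as E.
  replace (f (z + w) - g (z + w))%C with (f (z + w) + (- (1)) * g (z + w))%C by ring.
  eapply Cser_ext; [|exact E]. intros n. simpl. ring.
Qed.

Lemma Cser_shift_mul (a : nat -> C) (w l : C) :
  Cser (fun k => a k * w ^ k)%C l ->
  Cser (fun k => match k with O => 0 | S k => a k end * w ^ k)%C (w * l)%C.
Proof.
  intros H. apply Cser_decr_1. replace (w * l - 0 * w ^ 0)%C with (w * l)%C by ring.
  eapply Cser_ext; [| exact (Cser_scal w _ _ H)]. intros n. simpl. ring.
Qed.

Lemma has_Cpseries_mul_affine f z a r (p q : C) :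
  has_Cpseries f z a r ->
  has_Cpseries (fun s => (p + q * s) * f s)%C z
    (fun k => (p + q * z) * a k + q * match k with O => 0 | S k => a k end)%C r.
Proof.
  intros [Hr H]. split; auto. intros w Hw. specialize (H w Hw).
  pose proof (Cser_plus _ _ _ _ (Cser_scal (p + q * z)%C _ _ H) (Cser_scal q _ _ (Cser_shift_mul _ _ _ H))) as E.
  replace ((p + q * (z + w)) * f (z + w))%C with ((p + q * z) * f (z + w) + q * (w * f (z + w)))%C by ring.
  eapply Cser_ext; [|exact E]. intros n. simpl. ring.
Qed.

Lemma Cpseries_at_0 (a : nat -> C) (l : C) : Cser (fun k => a k * 0 ^ k)%C l -> l = a O.
Proof.
  intros H. apply Cser_incr_1 in H. simpl in H.
  assert (H0 : (l - a O * 1)%C = (0 * (l - a O * 1))%C).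
  { apply (Cser_unique _ _ _ H). eapply Cser_ext; [| exact (Cser_scal 0 _ _ H)]. intros n. simpl. ring. }
  replace l with ((l - a O * 1) + a O)%C by ring. rewrite H0. ring.
Qed.

Lemma has_Cpseries_at_center f z a r : has_Cpseries f z a r -> f z = a O.
Proof.
  intros [Hr H]. apply Cpseries_at_0. specialize (H 0). rewrite Cplus_0_r in H. apply H. now rewrite Cmod_0.
Qed.

Lemma has_Cpseries_is_derive f z a r :
  has_Cpseries f z a r -> @is_derive C_AbsRing C_NormedModule f z (a 1%nat).
Proof.
  intros [Hr H]. split. apply (is_linear_scal_l (K:=C_AbsRing) (V:=C_NormedModule)).
  intros x Hx eps. change C in x.
  assert (z = x).
  { apply (is_filter_lim_locally_unique (K:=C_AbsRing) (V:=AbsRing_NormedModule C_AbsRing)). exact Hx. }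
  subst x.
  assert (Hw0 : RtoC (r / 2) <> 0) by (apply RtoC_neq_0; lra).
  assert (Hc : Cmod (RtoC (r / 2)) = r / 2) by (apply Cmod_RtoC_pos; lra).
  destruct (Cpseries_remainder2 a (RtoC (r / 2)) (f (z + RtoC (r/2))%C) Hw0) as [B [HB0 HB]].
  { apply H. lra. }
  (* The bound [r / 4] stays within half of the reference point [r / 2], as the remainder estimate
     requires; [eps / (B + 1)] turns [B |w|^2] into at most [eps |w|]. *)
  assert (Hd : 0 < Rmin (r / 4) (eps / (B + 1))).
  { apply Rmin_glb_lt. lra. apply Rdiv_lt_0_compat. apply cond_pos. lra. }
  exists (mkposreal _ Hd). intros y Hy. change C in y.
  change (Cmod (y - z)%C < Rmin (r / 4) (eps / (B + 1))) in Hy.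
  change (Cmod ((f y - f z) - (y - z) * a 1%nat)%C <= eps * Cmod (y - z)%C).
  pose proof (Rlt_le_trans _ _ _ Hy (Rmin_l _ _)). pose proof (Rlt_le_trans _ _ _ Hy (Rmin_r _ _)) as H2.
  pose proof (Cmod_ge_0 (y - z)%C).
  assert (E0 : f z = a O) by exact (has_Cpseries_at_center f z a r (conj Hr H)).
  assert (Hr2 : Cmod (f y - a 0%nat - a 1%nat * (y - z))%C <= B * Cmod (y - z) ^ 2).
  { apply HB. rewrite Hc. lra. specialize (H (y - z)%C). replace (z + (y - z))%C with y in H by ring. apply H. lra. }
  rewrite E0. replace ((f y - a 0%nat) - (y - z) * a 1%nat)%C with (f y - a 0%nat - a 1%nat * (y - z))%C by ring.
  eapply Rle_trans. exact Hr2.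
  assert (Cmod (y - z)%C * (B + 1) <= eps).
  { apply Rle_trans with (eps / (B + 1) * (B + 1)). apply Rmult_le_compat_r; lra. right. field. lra. }
  nra.
Qed.

(** Absorbing [d ^ k] into the coefficients moves the ray to the positive real axis. Vanishing on
    one side of the centre suffices, which the supremum argument below relies on. *)
Lemma has_Cpseries_zero_on_ray (f : C -> C) (z d : C) (a : nat -> C) (r : R) :
  d <> 0 -> has_Cpseries f z a r -> (forall t, 0 < t -> f (z + RtoC t * d)%C = 0) ->
  forall k, a k = 0.
Proof.
  intros Hd [Hr H] H0 k.
  assert (Hp : 0 < Cmod d) by now apply Cmod_gt_0.
  assert (E : (a k * d ^ k)%C = 0).
  { apply (Cpseries_zero (fun k => a k * d ^ k)%C (r / Cmod d)). now apply Rdiv_lt_0_compat.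
    intros t [Ht1 Ht2]. rewrite <- (H0 t Ht1).
    apply (Cser_ext (fun k => a k * (RtoC t * d) ^ k)%C).
    - intros n. rewrite Cpow_mult_l. ring.
    - apply H. rewrite Cmod_mult, Cmod_RtoC_pos by lra.
      replace r with (r / Cmod d * Cmod d) by (field; lra). now apply Rmult_lt_compat_r. }
  destruct (Ceq_dec (a k) 0) as [|Hk]; auto. exfalso.
  now apply (Cmult_neq_0 _ _ Hk (Cpow_nz _ k Hd)).
Qed.

Lemma has_Cpseries_zero_coef (f : C -> C) (z : C) (a : nat -> C) (r : R) (w : C) :
  has_Cpseries f z a r -> (forall k, a k = 0) -> Cmod w < r -> f (z + w)%C = 0.
Proof.
  intros [Hr H] Ha Hw. specialize (H w Hw).
  replace (RtoC 0) with (0 * f (z + w))%C by ring.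
  apply (Cser_unique _ _ _ H). eapply Cser_ext; [| exact (Cser_scal 0 _ _ H)].
  intros n. simpl. rewrite Ha. ring.
Qed.

(** [P t] says that [f] vanishes on the ray strictly after [t]. If [P 0] failed, let [m] be the
    supremum of the [t >= 0] where [P] fails. Then [P m] holds, so the power series at the point of
    parameter [m] is zero; [f] vanishes on its whole disc, which also covers parameters before [m],
    against the choice of [m]. *)
Lemma analytic_ray_identity (f : C -> C) (z d : C) (T : R) :
  d <> 0 -> (forall t, 0 <= t -> analytic_at f (z + RtoC t * d)%C) ->
  (forall t, T < t -> f (z + RtoC t * d)%C = 0) ->
  forall a r, has_Cpseries f z a r -> forall k, a k = 0.
Proof.
  intros Hd Han HT a r Ha.
  pose (P := fun t => forall t', t < t' -> f (z + RtoC t' * d)%C = 0).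
  apply (has_Cpseries_zero_on_ray f z d a r Hd Ha). change (P 0).
  apply NNPP. intros HP.
  assert (Hmono : forall t1 t2, t1 <= t2 -> P t1 -> P t2) by (intros t1 t2 H12 H1 t' Ht'; apply H1; lra).
  destruct (completeness (fun t => 0 <= t /\ ~ P t)) as [m [Hub Hlub]].
  - exists T. intros t [_ Ht]. apply Rnot_lt_le. intros HTt. apply Ht. intros t' Ht'. apply HT. lra.
  - exists 0. split; auto. lra.
  - assert (Hm : 0 <= m) by (apply Hub; split; auto; lra).
    assert (Pm : P m).
    { intros t' Ht'. apply NNPP. intros Hn.
      assert (Hle : (m + t') / 2 <= m). { apply Hub. split. lra. intros HH. apply Hn. apply HH. lra. }
      lra. }
    destruct (proj1 (analytic_at_has_Cpseries _ _) (Han m Hm)) as [b [rho Hb]].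
    assert (Hb0 : forall k, b k = 0).
    { apply (has_Cpseries_zero_on_ray f _ d b rho Hd Hb). intros t Ht.
      rewrite <- (Pm (m + t)) by lra. f_equal. rewrite RtoC_plus. ring. }
    assert (Hp : 0 < Cmod d) by now apply Cmod_gt_0.
    assert (Hrho : 0 < rho) by apply Hb.
    assert (Hdel : 0 < rho / Cmod d) by now apply Rdiv_lt_0_compat.
    assert (HPd : P (m - rho / Cmod d)).
    { intros t Ht. destruct (Rlt_le_dec m t) as [|Hle]. now apply Pm.
      replace (z + RtoC t * d)%C with ((z + RtoC m * d) + RtoC (t - m) * d)%C by (rewrite RtoC_minus; ring).
      apply (has_Cpseries_zero_coef _ _ _ _ _ Hb Hb0).
      rewrite Cmod_mult, Cmod_R, Rabs_left1 by lra.
      replace rho with (rho / Cmod d * Cmod d) by (field; lra). apply Rmult_lt_compat_r; lra. }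
    assert (m <= m - rho / Cmod d); [|lra].
    apply Hlub. intros t [_ Ht]. apply Rnot_lt_le. intros Hlt. apply Ht. apply (Hmono _ t (Rlt_le _ _ Hlt) HPd).
Qed.

(** * The power series of the complex exponential *)

Lemma Cexp_plus a b : Cexp (a + b)%C = (Cexp a * Cexp b)%C.
Proof.
  unfold Cexp. rewrite re_plus, im_plus, exp_plus, cos_plus, sin_plus.
  unfold Cmult; cbn [fst snd]. f_equal; ring.
Qed.

Lemma Cmod_Cexp z : Cmod (Cexp z) = exp (Re z).
Proof.
  unfold Cexp, Cmod. cbn [fst snd].
  rewrite <- (sqrt_pow2 (exp (Re z))) at 3 by (left; apply exp_pos).
  f_equal. pose proof (sin2_cos2 (Im z)) as H. unfold Rsqr in H.
  transitivity (exp (Re z) ^ 2 * (sin (Im z) * sin (Im z) + cos (Im z) * cos (Im z))).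
  ring. rewrite H. ring.
Qed.

(** The factor [c] makes this family of real functions closed under differentiation, with [c]
    becoming [c * z], and lets one family cover real and imaginary parts. *)
Lemma is_derive_Re_Cexp (c z : C) (t : R) :
  is_derive (fun t => Re (c * Cexp (RtoC t * z))%C) t (Re (c * z * Cexp (RtoC t * z))%C).
Proof.
  destruct c as [c1 c2], z as [x y]. unfold Cexp, Re, Im, Cmult; simpl.
  auto_derive; auto.
  replace (t * x - 0 * y) with (t * x) by ring. replace (t * x + - (0 * y)) with (t * x) by ring.
  replace (t * y + 0 * x) with (t * y) by ring. ring.
Qed.

Lemma Derive_n_Re_Cexp (c z : C) (n : nat) (t : R) :
  Derive_n (fun t => Re (c * Cexp (RtoC t * z))%C) n t = Re (c * z ^ n * Cexp (RtoC t * z))%C.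
Proof.
  revert t. induction n as [|n IHn]; intros t.
  - replace (c * z ^ 0)%C with c by (simpl; ring). reflexivity.
  - replace (c * z ^ S n)%C with (c * z ^ n * z)%C by (simpl; ring).
    simpl Derive_n. rewrite (Derive_ext _ _ _ IHn).
    apply is_derive_unique, is_derive_Re_Cexp.
Qed.

Lemma ex_derive_n_Re_Cexp (c z : C) (n : nat) (t : R) :
  ex_derive_n (fun t => Re (c * Cexp (RtoC t * z))%C) n t.
Proof.
  destruct n; simpl; auto.
  apply (ex_derive_ext (fun t => Re (c * z ^ n * Cexp (RtoC t * z))%C)).
  - intros s. symmetry. apply Derive_n_Re_Cexp.
  - eexists. apply is_derive_Re_Cexp.
Qed.

Lemma is_series_exp x : is_series (fun k => x ^ k / INR (fact k)) (exp x).
Proof.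
  pose proof (proj1 (is_pseries_R _ _ _) (is_exp_Reals x)) as H.
  eapply is_series_ext; [|exact H]. intros n. simpl. unfold Rdiv. apply Rmult_comm.
Qed.

(** Taylor-Lagrange on [[0, 1]] for the real function [t -> Re (c * Cexp (t z))]. At the
    intermediate point [xi] one has [Re (xi z) <= |z|], so the remainder is at most
    [|c| e^|z| |z|^(n+1) / (n+1)!]. *)
Lemma is_series_Re_Cexp (c z : C) :
  is_series (fun k => Re (c * z ^ k)%C / INR (fact k)) (Re (c * Cexp z)%C).
Proof.
  change (is_lim_seq (sum_n (fun k => Re (c * z ^ k)%C / INR (fact k))) (Re (c * Cexp z)%C)).
  apply is_lim_seq_ext with (fun n => Re (c * Cexp z)%C - (Re (c * Cexp z)%C - sum_n (fun k => Re (c * z ^ k)%C / INR (fact k)) n)).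
  { intros n. match goal with |- ?A - (?A - ?B) = _ => change (A - (A - B) = B :> R) end; ring. }
  replace (Finite (Re (c * Cexp z)%C)) with (Finite (Re (c * Cexp z)%C - 0)) by (f_equal; ring).
  apply is_lim_seq_minus'. apply is_lim_seq_const.
  apply is_lim_seq_abs_0.
  apply (is_lim_seq_le_le (fun _ => 0) _ (fun n => Cmod c * exp (Cmod z) * (Cmod z ^ S n / INR (fact (S n))))).
  - intros n. split. apply Rabs_pos.
    destruct (Taylor_Lagrange (fun t => Re (c * Cexp (RtoC t * z))%C) n 0 1) as [xi [Hxi E]]. lra.
    { intros. apply ex_derive_n_Re_Cexp. }
    rewrite Cmult_1_l in E. rewrite E, Derive_n_Re_Cexp, sum_n_Reals.
    replace (sum_f_R0 (fun m : nat => (1 - 0) ^ m / INR (fact m) * Derive_n (fun t : R => Re (c * Cexp (t * z))%C) m 0) n)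
      with (sum_f_R0 (fun k : nat => Re (c * z ^ k)%C / INR (fact k)) n).
    2:{ apply sum_eq. intros i _. rewrite Derive_n_Re_Cexp, Rminus_0_r, pow1.
        replace (Cexp (RtoC 0 * z)%C) with (RtoC 1).
        rewrite Cmult_1_r. field. apply INR_fact_neq_0.
        rewrite Cmult_0_l. unfold Cexp; simpl. rewrite exp_0, cos_0, sin_0. unfold RtoC; f_equal; ring. }
    rewrite Rminus_0_r, pow1.
    match goal with |- Rabs (?A + ?B - ?A) <= _ => replace (A + B - A) with B by ring end.
    rewrite Rabs_mult. unfold Rdiv. rewrite Rmult_1_l, Rabs_inv, (Rabs_pos_eq (INR (fact (S n)))) by apply pos_INR.
    rewrite <- Rmult_assoc, (Rmult_comm _ (/ _)). apply Rmult_le_compat_l.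
    left. apply Rinv_0_lt_compat, INR_fact_lt_0.
    eapply Rle_trans. apply re_le_Cmod. rewrite !Cmod_mult, Cmod_pow, Cmod_Cexp.
    rewrite Rmult_assoc, Rmult_assoc. apply Rmult_le_compat_l. apply Cmod_ge_0.
    rewrite Rmult_comm. apply Rmult_le_compat_r. apply pow_le, Cmod_ge_0.
    rewrite re_scal_l. 
    assert (xi * Re z <= Cmod z).
    { eapply Rle_trans. apply Rle_abs. rewrite Rabs_mult, (Rabs_pos_eq xi) by lra.
      pose proof (re_le_Cmod z). pose proof (Rabs_pos (Re z)). nra. }
    destruct H as [H|H]. left. now apply exp_increasing. rewrite H. lra.
  - apply is_lim_seq_const.
  - replace (Finite 0) with (Rbar_mult (Cmod c * exp (Cmod z)) 0) by (simpl; f_equal; ring).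
    apply is_lim_seq_scal_l.
    apply (is_lim_seq_incr_1 (fun n => Cmod z ^ n / INR (fact n))).
    apply ex_series_lim_0. eexists. apply is_series_exp.
Qed.

Lemma Cser_Cexp (z : C) : Cser (fun k => RtoC (/ INR (fact k)) * z ^ k)%C (Cexp z).
Proof.
  apply Cser_Re_Im. split.
  - replace (Re (Cexp z)) with (Re (1 * Cexp z)%C) by (f_equal; ring).
    eapply is_series_ext; [| apply is_series_Re_Cexp]. intros n. cbv beta.
    replace (1 * z ^ n)%C with (z ^ n)%C by ring. rewrite re_scal_l. unfold Rdiv. apply Rmult_comm.
  (* The choice [c = -i] works because [Re (-i w) = Im w]. *)
  - replace (Im (Cexp z)) with (Re (- Ci * Cexp z)%C).
    2:{ unfold Ci, Copp, Cmult, Re, Im; simpl. ring. }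
    eapply is_series_ext; [| apply is_series_Re_Cexp]. intros n. cbv beta.
    rewrite im_scal_l. replace (Re (- Ci * z ^ n)%C) with (Im (z ^ n)%C). unfold Rdiv. apply Rmult_comm.
    unfold Ci, Copp. destruct (z ^ n)%C. unfold Cmult, Re, Im; simpl. ring.
Qed.

(** * Power series with absolutely summable coefficients *)

(* The bound is on the sum of the absolute values of the coefficients: unlike a
   sup norm, it passes to countable sums by exchanging two series. *)
Definition disc_coefs (f : C -> C) (s0 : C) (a : nat -> C) (M : R) : Prop :=
  (forall K, sum_n (fun k => Cmod (a k)) K <= M) /\
  (forall w, Cmod w <= 1 -> Cser (fun k => a k * w ^ k)%C (f (s0 + w)%C)).

Definition disc_bd (f : C -> C) (s0 : C) (M : R) : Prop := exists a, disc_coefs f s0 a M.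

Lemma disc_coefs_has_Cpseries f s0 a M : disc_coefs f s0 a M -> has_Cpseries f s0 a 1.
Proof. intros [_ H]. split. lra. intros w Hw. apply H. lra. Qed.

Lemma disc_bd_nonneg f s0 M : disc_bd f s0 M -> 0 <= M.
Proof.
  intros [a [H _]]. specialize (H O). rewrite sum_O in H. pose proof (Cmod_ge_0 (a O)). simpl in *. lra.
Qed.

Lemma disc_bd_le f s0 M M' : disc_bd f s0 M -> M <= M' -> disc_bd f s0 M'.
Proof. intros [a [H H']] HM. exists a. split; auto. intros K. specialize (H K). lra. Qed.

Lemma disc_bd_ext f g s0 M : (forall s, f s = g s) -> disc_bd f s0 M -> disc_bd g s0 M.
Proof. intros E [a [H H']]. exists a. split; auto. intros w Hw. rewrite <- E. auto. Qed.

Lemma sum_n_Rplus (a b : nat -> R) n : sum_n (fun k => a k + b k) n = sum_n a n + sum_n b n :> R.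
Proof. exact (sum_n_plus a b n). Qed.

Lemma sum_n_Rmult (c : R) (a : nat -> R) n : sum_n (fun k => c * a k) n = c * sum_n a n :> R.
Proof. exact (sum_n_mult_l (K:=R_Ring) c a n). Qed.

Lemma disc_bd_plus f g s0 M1 M2 :
  disc_bd f s0 M1 -> disc_bd g s0 M2 -> disc_bd (fun s => f s + g s)%C s0 (M1 + M2).
Proof.
  intros [a [H1 H1']] [b [H2 H2']]. exists (fun k => a k + b k)%C. split.
  - intros K. apply Rle_trans with (sum_n (fun k => Cmod (a k) + Cmod (b k)) K).
    apply sum_n_m_le. intros k. apply Cmod_triangle.
    rewrite sum_n_Rplus. specialize (H1 K). specialize (H2 K). lra.
  - intros w Hw. eapply Cser_ext; [| exact (Cser_plus _ _ _ _ (H1' w Hw) (H2' w Hw))].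
    intros n. simpl. ring.
Qed.

(** An operator norm bound for multiplication by [p] on the algebra of absolutely summable series.
    Such bounds compose, so polynomial factors are handled without Cauchy products. *)
Definition mult_bd (p : C -> C) (s0 : C) (m : R) : Prop :=
  0 <= m /\ forall f M, disc_bd f s0 M -> disc_bd (fun s => p s * f s)%C s0 (m * M).

Lemma mult_bd_le p s0 m m' : mult_bd p s0 m -> m <= m' -> mult_bd p s0 m'.
Proof.
  intros [H1 H2] Hm. split. lra. intros f M Hf. apply (disc_bd_le _ _ (m * M)). auto.
  apply Rmult_le_compat_r; auto. now apply disc_bd_nonneg in Hf.
Qed.

Lemma mult_bd_ext p p' s0 m : (forall s, p s = p' s) -> mult_bd p s0 m -> mult_bd p' s0 m.
Proof.
  intros E [H1 H2]. split; auto. intros f M Hf. apply (disc_bd_ext (fun s => p s * f s)%C); auto.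
  intros s. now rewrite E.
Qed.

Lemma mult_bd_const c s0 : mult_bd (fun _ => c) s0 (Cmod c).
Proof.
  split. apply Cmod_ge_0. intros f M [a [H H']]. exists (fun k => c * a k)%C. split.
  - intros K. apply Rle_trans with (sum_n (fun k => Cmod c * Cmod (a k)) K).
    apply sum_n_m_le. intros k. rewrite Cmod_mult. lra.
    rewrite sum_n_Rmult. apply Rmult_le_compat_l; auto. apply Cmod_ge_0.
  - intros w Hw. eapply Cser_ext; [| exact (Cser_scal c _ _ (H' w Hw))]. intros n. simpl. ring.
Qed.

(** On the disc [s = s0 + w], and multiplication by [w] shifts the coefficients without changing
    their absolute sum. *)
Lemma mult_bd_id s0 : mult_bd (fun s => s) s0 (Cmod s0 + 1).
Proof.
  split. pose proof (Cmod_ge_0 s0); lra. intros f M [a [H H']].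
  exists (fun k => s0 * a k + match k with O => 0 | S k => a k end)%C. split.
  - intros K. apply Rle_trans with (sum_n (fun k => Cmod s0 * Cmod (a k) + Cmod (match k with O => 0 | S k => a k end)) K).
    apply sum_n_m_le. intros k. eapply Rle_trans. apply Cmod_triangle. rewrite Cmod_mult. lra.
    rewrite sum_n_Rplus, sum_n_Rmult. 
    assert (sum_n (fun k => Cmod (match k with O => 0 | S k => a k end)) K <= M).
    { destruct K. rewrite sum_O, Cmod_0. apply disc_bd_nonneg with f s0. exists a; split; auto.
      replace (sum_n (fun k => Cmod (match k with O => 0 | S k => a k end)) (S K)) with (sum_n (fun k => Cmod (a k)) K). auto.
      induction K. rewrite Rsum_n_S, !sum_O, Cmod_0. simpl. ring.
      rewrite Rsum_n_S, IHK, (Rsum_n_S _ (S K)). reflexivity. }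
    assert (Cmod s0 * sum_n (fun k => Cmod (a k)) K <= Cmod s0 * M).
    { apply Rmult_le_compat_l; auto. apply Cmod_ge_0. }
    lra.
  - intros w Hw. replace ((s0 + w) * f (s0 + w))%C with (s0 * f (s0 + w) + w * f (s0 + w))%C by ring.
    eapply Cser_ext; [| exact (Cser_plus _ _ _ _ (Cser_scal s0 _ _ (H' w Hw)) (Cser_shift_mul _ _ _ (H' w Hw)))].
    intros n. simpl. ring.
Qed.

Lemma mult_bd_plus p1 p2 s0 m1 m2 :
  mult_bd p1 s0 m1 -> mult_bd p2 s0 m2 -> mult_bd (fun s => p1 s + p2 s)%C s0 (m1 + m2).
Proof.
  intros [H1 H1'] [H2 H2']. split. lra. intros f M Hf.
  rewrite Rmult_plus_distr_r. apply (disc_bd_ext (fun s => p1 s * f s + p2 s * f s)%C).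
  intros s; ring. apply disc_bd_plus; auto.
Qed.

Lemma mult_bd_mult p1 p2 s0 m1 m2 :
  mult_bd p1 s0 m1 -> mult_bd p2 s0 m2 -> mult_bd (fun s => p1 s * p2 s)%C s0 (m1 * m2).
Proof.
  intros [H1 H1'] [H2 H2']. split. now apply Rmult_le_pos. intros f M Hf.
  rewrite Rmult_assoc. apply (disc_bd_ext (fun s => p1 s * (p2 s * f s))%C).
  intros s; ring. apply H1'. now apply H2'.
Qed.

Lemma mult_bd_pow p s0 m j : mult_bd p s0 m -> mult_bd (fun s => p s ^ j)%C s0 (m ^ j).
Proof.
  intros H. induction j.
  - apply (mult_bd_le _ _ (Cmod 1)). apply (mult_bd_const 1). rewrite Cmod_1. simpl; lra.
  - apply (mult_bd_mult p (fun s => p s ^ j)%C); auto.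
Qed.

Lemma mult_bd_scal c p s0 m : mult_bd p s0 m -> mult_bd (fun s => c * p s)%C s0 (Cmod c * m).
Proof. intros H. apply (mult_bd_mult (fun _ => c) p); auto. apply mult_bd_const. Qed.

Lemma is_series_sum_n (c : nat -> nat -> R) (b : nat -> R) (K : nat) :
  (forall k, is_series (fun N => c N k) (b k)) -> is_series (fun N => sum_n (c N) K) (sum_n b K).
Proof.
  intros H. induction K.
  - rewrite sum_O. apply (is_series_ext (fun N => c N O)); auto. intros n; now rewrite sum_O.
  - rewrite Rsum_n_S. apply (is_series_ext (fun N => sum_n (c N) K + c N (S K))).
    intros n; now rewrite Rsum_n_S. now apply (is_series_plus (fun N => sum_n (c N) K) (fun N => c N (S K))).
Qed.

Lemma is_series_le_bound (a M : nat -> R) (l m : R) :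
  (forall n, a n <= M n) -> is_series a l -> is_series M m -> l <= m.
Proof.
  intros H H1 H2. apply (is_lim_seq_le (sum_n a) (sum_n M) l m); auto.
  intros n. now apply sum_n_m_le.
Qed.

Lemma term_le_sum_n (a : nat -> R) k : (forall n, 0 <= a n) -> a k <= sum_n a k.
Proof.
  intros H. destruct k. rewrite sum_O. lra. rewrite Rsum_n_S.
  assert (0 <= sum_n a k); [|lra]. clear -H. induction k. rewrite sum_O; auto. rewrite Rsum_n_S. specialize (H (S k)). lra.
Qed.

(** Since [|a N k| <= M N], the coefficients can be summed over [N] for each [k]; exchanging sums of
    absolute values bounds the result. The coefficients [b] stay visible because the derivative of
    the sum is later read off as the sum of the coefficients of index 1. *)
Lemma disc_coefs_series (f : nat -> C -> C) (F : C -> C) (s0 : C) (a : nat -> nat -> C) (M : nat -> R) (m : R) :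
  (forall N, disc_coefs (f N) s0 (a N) (M N)) -> is_series M m ->
  (forall w, Cmod w <= 1 -> Cser (fun N => f N (s0 + w)%C) (F (s0 + w)%C)) ->
  exists b, (forall k, Cser (fun N => a N k) (b k)) /\ disc_coefs F s0 b m.
Proof.
  intros Ha HM HF.
  assert (Hle : forall N k, Cmod (a N k) <= M N).
  { intros N k. eapply Rle_trans; [|apply (proj1 (Ha N) k)].
    apply (term_le_sum_n (fun k => Cmod (a N k))). intros; apply Cmod_ge_0. }
  assert (HexM : ex_series M) by now exists m.
  destruct (functional_choice (fun k b => Cser (fun N => a N k) b)) as [b Hb].
  { intros k. apply (Cser_ex_abs _ M); auto. }
  exists b. split; auto. split.
  - destruct (functional_choice (fun k l => is_series (fun N => Cmod (a N k)) l)) as [l Hl].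
    { intros k. apply (ex_series_le (K:=R_AbsRing) (V:=R_CompleteNormedModule) _ M); auto.
      intros n. eapply Rle_trans; [|apply (Hle n k)]. right. apply Rabs_pos_eq, Cmod_ge_0. }
    intros K. apply Rle_trans with (sum_n l K).
    + apply sum_n_m_le. intros k. apply (Cmod_Cser_le _ _ _ (Hb k)). intros n.
      apply (sum_n_le_loc_nonneg (fun N => Cmod (a N k))); auto. intros; apply Cmod_ge_0.
    + apply (is_series_le_bound (fun N => sum_n (fun k => Cmod (a N k)) K) M); auto.
      * intros n. apply (proj1 (Ha n)).
      * now apply (is_series_sum_n (fun N k => Cmod (a N k))).
  - intros w Hw. apply (Cser_fubini (fun N k => a N k * w ^ k)%C M _ (fun N => f N (s0 + w)%C)); auto.
    + intros N K. eapply Rle_trans; [|apply (proj1 (Ha N) K)]. apply sum_n_m_le. intros k.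
      rewrite Cmod_mult, Cmod_pow. rewrite <- (Rmult_1_r (Cmod (a N k))) at 2.
      apply Rmult_le_compat_l. apply Cmod_ge_0. rewrite <- (pow1 k). apply pow_incr. split; auto. apply Cmod_ge_0.
    + intros N. now apply (proj2 (Ha N)).
    + intros k. eapply Cser_ext; [|rewrite Cmult_comm; exact (Cser_scal (w ^ k)%C _ _ (Hb k))].
      intros n. simpl. ring.
Qed.

Lemma disc_bd_series (f : nat -> C -> C) (F : C -> C) (s0 : C) (M : nat -> R) (m : R) :
  (forall N, disc_bd (f N) s0 (M N)) -> is_series M m ->
  (forall w, Cmod w <= 1 -> Cser (fun N => f N (s0 + w)%C) (F (s0 + w)%C)) ->
  disc_bd F s0 m.
Proof.
  intros H HM HF.
  destruct (functional_choice (fun N a => disc_coefs (f N) s0 a (M N)) H) as [a Ha].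
  destruct (disc_coefs_series f F s0 a M m Ha HM HF) as [b [_ Hb]]. now exists b.
Qed.

Lemma disc_bd_Cexp (al be s0 : C) :
  disc_bd (fun s => Cexp (be + al * s)%C) s0 (exp (Re (be + al * s0)%C) * exp (Cmod al)).
Proof.
  exists (fun k => Cexp (be + al * s0) * (RtoC (/ INR (fact k)) * al ^ k))%C. split.
  - intros K. apply Rle_trans with (sum_n (fun k => exp (Re (be + al * s0)%C) * (Cmod al ^ k / INR (fact k))) K).
    + apply sum_n_m_le. intros k. rewrite !Cmod_mult, Cmod_Cexp, Cmod_pow, Cmod_RtoC_pos.
      right. unfold Rdiv. ring. left. apply Rinv_0_lt_compat, INR_fact_lt_0.
    + rewrite sum_n_Rmult. apply Rmult_le_compat_l. left; apply exp_pos.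
      apply sum_n_le_loc_nonneg. intros k. apply Rmult_le_pos. apply pow_le, Cmod_ge_0.
      left. apply Rinv_0_lt_compat, INR_fact_lt_0. apply is_series_exp.
  - intros w Hw. replace (be + al * (s0 + w))%C with ((be + al * s0) + al * w)%C by ring.
    rewrite (Cexp_plus (be + al * s0) (al * w)). eapply Cser_ext; [|exact (Cser_scal (Cexp (be + al * s0))%C _ _ (Cser_Cexp (al * w)%C))].
    intros n. cbv beta. rewrite Cpow_mult_l. ring.
Qed.

(** * The Euler-Maclaurin correction *)

(* Coefficient of [y^j / j!] in [n^(s-1) em_term n s], where [y = ln (1 + 1/n)]. *)
Definition em_coef (j : nat) (s : C) : C :=
  (/ 2 * ((1 - s) * ((1 - s) ^ j + 1 - (- s) ^ j - 0 ^ j))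
   - ((1 - s) ^ j - 0 ^ j)
   + / 12 * (s * (1 - s) * ((1 - s) ^ j - 2 * (- s) ^ j + (- (1 + s)) ^ j - 2 ^ j + 2 - 0 ^ j)))%C.

(* Increment from [n] to [n + 1] of the partial Euler-Maclaurin expression
   [(1-s) sum_(k <= n) k^(-s) - n^(1-s) - (1-s)/2 n^(-s) + s(1-s)/12 n^(-s-1)];
   [em_start] below is its value at [n = 1]. *)
Definition em_term (n : nat) (s : C) : C :=
  (/ 2 * ((1 - s) * (nat_Cpow (S n) (- s) + nat_Cpow n (- s)))
   - (nat_Cpow (S n) (1 - s) - nat_Cpow n (1 - s))
   + / 12 * (s * (1 - s) * (nat_Cpow (S n) (- (1 + s)) - nat_Cpow n (- (1 + s)))))%C.

(** After the trapezoidal and [B_2] corrections, the local error has the size of the fourth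
    derivative of [x^(-s)], namely [n^(-s-4)]: five orders below [n^(1-s)]. *)
Lemma em_coef_0 j s : (j < 5)%nat -> em_coef j s = 0.
Proof.
  intros H. assert (H2 : RtoC 2 <> 0) by (apply RtoC_neq_0; lra).
  assert (H12 : RtoC 12 <> 0) by (apply RtoC_neq_0; lra).
  unfold em_coef.
  do 5 (destruct j as [|j]; [simpl; field; auto|]). lia.
Qed.

Lemma nat_Cpow_plus n a b : nat_Cpow n (a + b)%C = (nat_Cpow n a * nat_Cpow n b)%C.
Proof. unfold nat_Cpow. rewrite <- Cexp_plus. f_equal. ring. Qed.

Lemma Cexp_RtoC x : Cexp (RtoC x) = RtoC (exp x).
Proof. unfold Cexp; simpl. rewrite cos_0, sin_0. unfold RtoC. f_equal; ring. Qed.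

Lemma nat_Cpow_1 n : (0 < n)%nat -> nat_Cpow n 1 = RtoC (INR n).
Proof.
  intros H. unfold nat_Cpow. rewrite Cmult_1_l, Cexp_RtoC, exp_ln; auto. now apply lt_0_INR.
Qed.

Lemma nat_Cpow_succ n s : (0 < n)%nat ->
  nat_Cpow (S n) s = (nat_Cpow n s * Cexp (s * RtoC (ln (INR (S n)) - ln (INR n))))%C.
Proof. intros H. unfold nat_Cpow. rewrite <- Cexp_plus. f_equal. rewrite RtoC_minus. ring. Qed.

Lemma Cser_Cexp_mul (l : C) (y : R) :
  Cser (fun j => l ^ j * RtoC (y ^ j / INR (fact j)))%C (Cexp (l * RtoC y))%C.
Proof.
  eapply Cser_ext; [|apply Cser_Cexp]. intros n. cbv beta. unfold Rdiv.
  rewrite RtoC_mult, RtoC_pow, Cpow_mult_l. ring.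
Qed.

Lemma Cser_minus (a b : nat -> C) (la lb : C) :
  Cser a la -> Cser b lb -> Cser (fun n => a n - b n)%C (la - lb)%C.
Proof.
  intros Ha Hb. apply (Cser_scal (-(1))%C) in Hb.
  replace (la - lb)%C with (la + -(1) * lb)%C by ring.
  eapply Cser_ext; [|exact (Cser_plus _ _ _ _ Ha Hb)]. intros n; simpl; ring.
Qed.

(** Since [1/n = e^y - 1], the powers of [n] in [em_term] become exponentials in [y]: the brackets
    are the expansions of [(e^(-s y) + 1) (e^y - 1)] and [(e^(-(1+s) y) - 1) (e^y - 1)^2]. The terms
    [0 ^ j] of [em_coef] come from the constant [1 = e^(0 y)]. *)
Lemma Cser_em_coef (s : C) (y : R) :
  let e l := Cexp (l * RtoC y)%C in
  Cser (fun j => em_coef j s * RtoC (y ^ j / INR (fact j)))%C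
  (/ 2 * ((1 - s) * (e (1 - s)%C + e 1 - e (- s)%C - 1))
   - (e (1 - s)%C - 1)
   + / 12 * (s * (1 - s) * (e (1 - s)%C - 2 * e (- s)%C + e (- (1 + s))%C - e 2 + 2 * e 1 - 1)))%C.
Proof.
  intros e.
  assert (He : forall l, Cser (fun j => l ^ j * RtoC (y ^ j / INR (fact j)))%C (e l)) by (intros; apply Cser_Cexp_mul).
  assert (E0 : Cser (fun j => 0 ^ j * RtoC (y ^ j / INR (fact j)))%C 1).
  { replace (RtoC 1) with (e 0). apply He. unfold e. rewrite Cmult_0_l, Cexp_RtoC. now rewrite exp_0. }
  pose proof (Cser_scal (/2 * (1 - s))%C _ _ (Cser_minus _ _ _ _ (Cser_minus _ _ _ _ (Cser_plus _ _ _ _ (He (1-s)%C) (He 1)) (He (-s)%C)) E0)) as P1.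
  pose proof (Cser_minus _ _ _ _ (He (1 - s)%C) E0) as P2.
  pose proof (Cser_scal (/12 * (s * (1 - s)))%C _ _
   (Cser_minus _ _ _ _ (Cser_plus _ _ _ _ (Cser_minus _ _ _ _ (Cser_plus _ _ _ _ (Cser_minus _ _ _ _ (He (1-s)%C) (Cser_scal 2 _ _ (He (-s)%C))) (He (-(1+s))%C)) (He 2)) (Cser_scal 2 _ _ (He 1))) E0)) as P3.
  pose proof (Cser_plus _ _ _ _ (Cser_minus _ _ _ _ P1 P2) P3) as P.
  match type of P with Cser _ ?l => match goal with |- Cser _ ?l' => replace l' with l by ring end end.
  eapply Cser_ext; [|exact P]. intros j. cbv beta. unfold em_coef. rewrite (Cpow_1_l j). ring.
Qed.

Lemma em_term_series n s : (0 < n)%nat ->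
  let y := ln (INR (S n)) - ln (INR n) in
  Cser (fun j => nat_Cpow n (1 - s) * (em_coef (5 + j) s * RtoC (y ^ (5 + j) / INR (fact (5 + j)))))%C (em_term n s).
Proof.
  intros Hn y.
  pose proof (Cser_scal (nat_Cpow n (1 - s)) _ _ (Cser_em_coef s y)) as H.
  set (e := fun l => Cexp (l * RtoC y)%C) in H.
  do 5 apply Cser_incr_1 in H.
  rewrite !em_coef_0 in H by lia.
  match type of H with Cser _ ?l => replace l with (em_term n s) in H end. exact H.
  clear H.
  assert (HR : 0 < INR n) by now apply lt_0_INR.
  assert (HS : 0 < INR (S n)) by (apply lt_0_INR; lia).
  assert (Hy : INR n * exp y = INR n + 1).
  { unfold y, Rminus. rewrite exp_plus, exp_Ropp, !exp_ln by auto. rewrite S_INR. field. lra. }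
  (* With [g = e^(-(1+s) y)] and, below, [v = n^(-(1+s))] as base quantities, every other power is
     one of them times powers of [n] or of [e^y = 1 + 1/n], so a rational identity remains. *)
  set (g := e (- (1 + s))%C).
  assert (E1 : e 1 = RtoC (exp y)) by (unfold e; rewrite Cmult_1_l; apply Cexp_RtoC).
  assert (Hadd : forall a b, e (a + b)%C = (e a * e b)%C).
  { intros a b. unfold e. rewrite <- Cexp_plus. f_equal. ring. }
  assert (E2 : e 2 = (e 1 * e 1)%C) by (rewrite <- Hadd; f_equal; ring).
  assert (E3 : e (- s)%C = (g * e 1)%C) by (unfold g; rewrite <- Hadd; f_equal; ring).
  assert (E4 : e (1 - s)%C = (g * e 1 * e 1)%C) by (unfold g; rewrite <- !Hadd; f_equal; ring).
  rewrite E4, E3, E2.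
  unfold em_term. rewrite !nat_Cpow_succ by auto. fold y.
  change (Cexp (- s * RtoC y)) with (e (- s)%C).
  change (Cexp ((1 - s) * RtoC y)) with (e (1 - s)%C).
  change (Cexp (- (1 + s) * RtoC y)) with g.
  rewrite E4, E3.
  set (v := nat_Cpow n (- (1 + s))%C).
  assert (V1 : nat_Cpow n (- s)%C = (v * RtoC (INR n))%C).
  { rewrite <- (nat_Cpow_1 n Hn). unfold v. rewrite <- nat_Cpow_plus. f_equal. ring. }
  assert (V2 : nat_Cpow n (1 - s)%C = (v * RtoC (INR n) * RtoC (INR n))%C).
  { rewrite <- (nat_Cpow_1 n Hn). unfold v. rewrite <- !nat_Cpow_plus. f_equal. ring. }
  rewrite V1, V2.
  assert (EY : e 1 = (1 + / RtoC (INR n))%C).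
  { rewrite E1. replace (exp y) with (1 + / INR n). rewrite RtoC_plus, RtoC_inv; auto. lra.
    apply (Rmult_eq_reg_l (INR n)); [|lra]. rewrite Hy. field. lra. }
  rewrite EY. generalize g, v, (RtoC_neq_0 (INR n)). intros.
  field. repeat split; apply RtoC_neq_0; lra.
Qed.

Lemma Cmod_inv_nat_le_1 (x : R) : 1 <= x -> Cmod (/ RtoC x)%C <= / x.
Proof.
  intros H. rewrite <- RtoC_inv by lra. rewrite Cmod_RtoC_pos. lra. left. apply Rinv_0_lt_compat; lra.
Qed.

(** [L = |s0| + 3] bounds multiplication by each base [1 - s], [-s], [-(1+s)], 0, 1, 2. The
    prefactor collects four powers with weight [L / 2], two with weight 1, and powers of total
    weight 8 with factor [L^2 / 12]. *)
Lemma em_coef_mult_bd j s0 :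
  mult_bd (em_coef j) s0 ((2 * (Cmod s0 + 3) + 2 + (Cmod s0 + 3) ^ 2) * (Cmod s0 + 3) ^ j).
Proof.
  set (L := Cmod s0 + 3).
  assert (HL : 3 <= L) by (unfold L; pose proof (Cmod_ge_0 s0); lra).
  assert (HLj : 1 <= L ^ j) by (apply pow_R1_Rle; lra).
  assert (Hc : forall c : C, Cmod c <= L -> mult_bd (fun _ => c ^ j)%C s0 (L ^ j)).
  { intros c Hc. apply (mult_bd_pow (fun _ => c)). apply (mult_bd_le _ _ _ _ (mult_bd_const c s0) Hc). }
  assert (H1 : mult_bd (fun _ => 1) s0 (L ^ j)).
  { apply (mult_bd_le _ _ _ _ (mult_bd_const 1 s0)). rewrite Cmod_1; lra. }
  assert (Hs : mult_bd (fun s => s) s0 L) by (apply (mult_bd_le _ _ _ _ (mult_bd_id s0)); unfold L; lra).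
  assert (Hns : mult_bd (fun s => -(1) * s)%C s0 (L - 1)).
  { apply (mult_bd_le _ _ (Cmod (-(1))%C * (Cmod s0 + 1))). apply mult_bd_scal, mult_bd_id.
    rewrite Cmod_m1. unfold L; lra. }
  assert (H1s : mult_bd (fun s => 1 - s)%C s0 L).
  { apply (mult_bd_ext (fun s => 1 + -(1) * s)%C). intros; ring.
    apply (mult_bd_le _ _ (Cmod 1 + (L - 1))). apply mult_bd_plus; auto. apply mult_bd_const. rewrite Cmod_1; lra. }
  assert (Hms : mult_bd (fun s => - (1 + s))%C s0 L).
  { apply (mult_bd_ext (fun s => -(1) + -(1) * s)%C). intros; ring.
    apply (mult_bd_le _ _ (Cmod (-(1))%C + (L - 1))). apply mult_bd_plus; auto. apply mult_bd_const. rewrite Cmod_m1; lra. }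
  assert (Hns' : mult_bd (fun s => - s)%C s0 L).
  { apply (mult_bd_ext (fun s => -(1) * s)%C). intros; ring. apply (mult_bd_le _ _ _ _ Hns). lra. }
  apply (mult_bd_pow _ _ _ j) in H1s as P1. apply (mult_bd_pow _ _ _ j) in Hns' as P2.
  apply (mult_bd_pow _ _ _ j) in Hms as P3.
  assert (P0 : mult_bd (fun _ => 0 ^ j)%C s0 (L ^ j)) by (apply Hc; rewrite Cmod_0; lra).
  assert (P4 : mult_bd (fun _ => 2 ^ j)%C s0 (L ^ j)) by (apply Hc; rewrite Cmod_RtoC_pos; lra).
  pose proof (mult_bd_scal (/2) _ _ _ (mult_bd_mult _ _ _ _ _ H1s
    (mult_bd_plus _ _ _ _ _ (mult_bd_plus _ _ _ _ _ (mult_bd_plus _ _ _ _ _ P1 H1) (mult_bd_scal (-(1)) _ _ _ P2)) (mult_bd_scal (-(1)) _ _ _ P0)))) as Q1.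
  pose proof (mult_bd_plus _ _ _ _ _ (mult_bd_scal (-(1)) _ _ _ P1) P0) as Q2.
  pose proof (mult_bd_scal (/12) _ _ _ (mult_bd_mult _ _ _ _ _ (mult_bd_mult _ _ _ _ _ Hs H1s)
    (mult_bd_plus _ _ _ _ _ (mult_bd_plus _ _ _ _ _ (mult_bd_plus _ _ _ _ _ (mult_bd_plus _ _ _ _ _ (mult_bd_plus _ _ _ _ _
      P1 (mult_bd_scal (-(2)) _ _ _ P2)) P3) (mult_bd_scal (-(1)) _ _ _ P4)) (mult_bd_scal 2 _ _ _ H1)) (mult_bd_scal (-(1)) _ _ _ P0)))) as Q3.
  pose proof (mult_bd_plus _ _ _ _ _ (mult_bd_plus _ _ _ _ _ Q1 Q2) Q3) as Q.
  apply (mult_bd_ext _ (em_coef j)) in Q.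
  2:{ intros s. unfold em_coef. ring. }
  apply (mult_bd_le _ _ _ _ Q).
  rewrite !Cmod_opp, Cmod_1. 
  pose proof (Cmod_inv_nat_le_1 2 ltac:(lra)) as I2. pose proof (Cmod_inv_nat_le_1 12 ltac:(lra)) as I12.
  rewrite (Cmod_RtoC_pos 2) by lra.
  pose proof (Cmod_ge_0 (/2)) as I2'. pose proof (Cmod_ge_0 (/12)) as I12'.
  set (X := L ^ j) in *.
  assert (0 <= L * X) by nra. assert (0 <= L * L * X) by nra.
  assert (Cmod (/2) * (L * X) <= /2 * (L * X)) by (apply Rmult_le_compat_r; auto).
  assert (Cmod (/12) * (L * L * X) <= /12 * (L * L * X)) by (apply Rmult_le_compat_r; auto).
  lra.
Qed.

(** The absolute coefficient sum is [n^(1 - Re s0) * e^(ln n)], at most [n^3]; this is no worse than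
    the supremum of [|n^(1-s)|] over discs reaching [Re s = -2]. *)
Lemma nat_Cpow_disc_bd n s0 : (0 < n)%nat -> -1 <= Re s0 ->
  disc_bd (fun s => nat_Cpow n (1 - s)%C) s0 (INR n ^ 3).
Proof.
  intros Hn Hs.
  assert (HR : 1 <= INR n) by (apply (le_INR 1); lia).
  assert (HL : 0 <= ln (INR n)). { rewrite <- ln_1. destruct HR as [HR|HR]. left; apply ln_increasing; lra. rewrite HR; lra. }
  apply (disc_bd_ext (fun s => Cexp (RtoC (ln (INR n)) + - RtoC (ln (INR n)) * s)%C)).
  { intros s. unfold nat_Cpow. f_equal. ring. }
  apply (disc_bd_le _ _ _ _ (disc_bd_Cexp _ _ _)).
  rewrite Cmod_opp, Cmod_RtoC_pos by auto. rewrite <- exp_plus.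
  replace (INR n ^ 3) with (exp (3 * ln (INR n))).
  2:{ replace (3 * ln (INR n)) with (ln (INR n) + ln (INR n) + ln (INR n)) by ring.
      rewrite !exp_plus, !exp_ln by lra. ring. }
  assert (Re (RtoC (ln (INR n)) + - RtoC (ln (INR n)) * s0)%C + ln (INR n) <= 3 * ln (INR n)) as [H|H].
  { rewrite <- RtoC_opp, re_plus, re_scal_l, re_RtoC. nra. }
  left; now apply exp_increasing. rewrite H; lra.
Qed.

Lemma ln_succ_bound n : (0 < n)%nat -> 0 <= ln (INR (S n)) - ln (INR n) <= / INR n.
Proof.
  intros Hn. assert (HR : 0 < INR n) by now apply lt_0_INR.
  assert (HS : INR (S n) = INR n + 1) by apply S_INR.
  split.
  - assert (ln (INR n) < ln (INR (S n))) by (apply ln_increasing; lra). lra.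
  - rewrite <- ln_div by lra. replace (INR (S n) / INR n) with (1 + / INR n) by (rewrite HS; field; lra).
    assert (0 < / INR n) by now apply Rinv_0_lt_compat.
    rewrite <- (ln_exp (/ INR n)) at 2. left. apply ln_increasing. lra. apply exp_ineq1. lra.
Qed.

Lemma fact_le_add j k : INR (fact j) <= INR (fact (k + j)).
Proof. apply le_INR. apply fact_le. lia. Qed.

(** From [y <= 1/n <= 1] one gets [y^(5+j) <= n^(-5)], which against [n^3] leaves [n^(-2)].
    Weakening [(5+j)!] to [j!] makes the sum over [j] of the powers of [L] an exponential. *)
Lemma em_term_disc_bd s0 : -1 <= Re s0 ->
  exists K, 0 <= K /\ forall n, (0 < n)%nat -> disc_bd (em_term n) s0 (K / INR n ^ 2).
Proof.
  intros Hs. set (L := Cmod s0 + 3).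
  assert (HL : 3 <= L) by (unfold L; pose proof (Cmod_ge_0 s0); lra).
  set (C0 := 2 * L + 2 + L ^ 2). assert (HC0 : 0 <= C0) by (unfold C0; nra).
  exists (C0 * L ^ 5 * exp L). split.
  { apply Rmult_le_pos. apply Rmult_le_pos; auto. apply pow_le; lra. left; apply exp_pos. }
  intros n Hn. set (y := ln (INR (S n)) - ln (INR n)).
  pose proof (ln_succ_bound n Hn) as Hy. fold y in Hy.
  assert (HR : 1 <= INR n) by (apply (le_INR 1); lia).
  assert (Hi : / INR n <= 1) by (rewrite <- Rinv_1; apply Rinv_le_contravar; lra).
  apply (disc_bd_series (fun j s => nat_Cpow n (1 - s) * (em_coef (5 + j) s * RtoC (y ^ (5 + j) / INR (fact (5 + j)))))%C _ _
    (fun j => C0 * L ^ 5 / INR n ^ 2 * (L ^ j / INR (fact j)))).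
  - intros j.
    apply (disc_bd_ext (fun s => RtoC (y ^ (5 + j) / INR (fact (5 + j))) * (em_coef (5 + j) s * nat_Cpow n (1 - s)))%C).
    { intros s. ring. }
    pose proof (proj2 (mult_bd_const (RtoC (y ^ (5 + j) / INR (fact (5 + j)))) s0) _ _
      (proj2 (em_coef_mult_bd (5 + j) s0) _ _ (nat_Cpow_disc_bd n s0 Hn Hs))) as H.
    apply (disc_bd_le _ _ _ _ H). clear H. fold L. fold C0.
    assert (Hf : 0 < INR (fact j)) by apply INR_fact_lt_0.
    assert (Hf5 : 0 < INR (fact (5 + j))) by apply INR_fact_lt_0.
    pose proof (fact_le_add j 5) as Hff.
    assert (Hyj : 0 <= y ^ (5 + j) <= / INR n ^ 5).
    { split. apply pow_le; lra. rewrite pow_add, <- pow_inv by lra.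
      rewrite <- (Rmult_1_r ((/ INR n) ^ 5)). apply Rmult_le_compat. apply pow_le; lra. apply pow_le; lra.
      apply pow_incr; lra. rewrite <- (pow1 j). apply pow_incr. lra. }
    rewrite Cmod_RtoC_pos. 2:{ apply Rmult_le_pos. lra. left; now apply Rinv_0_lt_compat. }
    apply Rle_trans with (/ INR n ^ 5 / INR (fact j) * (C0 * L ^ (5 + j) * INR n ^ 3)).
    + apply Rmult_le_compat_r.
      apply Rmult_le_pos. apply Rmult_le_pos; auto. apply pow_le; lra. apply pow_le; lra.
      apply Rmult_le_compat. lra. left; now apply Rinv_0_lt_compat. lra. now apply Rinv_le_contravar.
    + right. rewrite pow_add. field. split; lra.
  - replace (C0 * L ^ 5 * exp L / INR n ^ 2) with (C0 * L ^ 5 / INR n ^ 2 * exp L) by (field; lra).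
    apply (is_series_scal (C0 * L ^ 5 / INR n ^ 2) (fun j => L ^ j / INR (fact j))). apply is_series_exp.
  - intros w Hw. apply em_term_series. exact Hn.
Qed.

Lemma sum_inv_sqr_bound n : sum_n (fun k => / INR (S k) ^ 2) n <= 2 - / INR (S n).
Proof.
  induction n. rewrite sum_O. simpl. lra.
  rewrite Rsum_n_S.
  assert (H : 0 < INR (S n)) by (apply lt_0_INR; lia).
  rewrite (S_INR (S n)).
  assert (/ (INR (S n) + 1) ^ 2 <= / INR (S n) - / (INR (S n) + 1)); [|lra].
  replace (/ INR (S n) - / (INR (S n) + 1)) with (/ (INR (S n) * (INR (S n) + 1))) by (field; lra).
  apply Rinv_le_contravar; nra.
Qed.

Lemma ex_series_inv_sqr : ex_series (fun k => / INR (S k) ^ 2).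
Proof.
  destruct (nonneg_series_bounded (fun k => / INR (S k) ^ 2) 2) as [l [Hl _]].
  - intros n. left. apply Rinv_0_lt_compat, pow_lt, lt_0_INR. lia.
  - intros n. eapply Rle_trans. apply sum_inv_sqr_bound.
    assert (0 < / INR (S n)) by (apply Rinv_0_lt_compat, lt_0_INR; lia). lra.
  - now exists l.
Qed.

(** * The summed corrections and their relation to [zeta] *)

Definition Csum (a : nat -> C) : C := (Series (fun n => Re (a n)), Series (fun n => Im (a n))).

Lemma Csum_unique a l : Cser a l -> Csum a = l.
Proof.
  rewrite Cser_Re_Im. intros [H1 H2]. unfold Csum.
  rewrite (is_series_unique _ _ H1), (is_series_unique _ _ H2). now destruct l.
Qed.

Lemma Cser_Csum a l : Cser a l -> Cser a (Csum a).
Proof. intros H. now rewrite (Csum_unique _ _ H). Qed.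

Lemma disc_bd_Cmod f s0 M w : disc_bd f s0 M -> Cmod w <= 1 -> Cmod (f (s0 + w)%C) <= M.
Proof.
  intros [a [H1 H2]] Hw. apply (Cmod_Cser_le _ _ _ (H2 w Hw)). intros n.
  eapply Rle_trans; [|apply (H1 n)]. apply sum_n_m_le. intros k.
  rewrite Cmod_mult, Cmod_pow. rewrite <- (Rmult_1_r (Cmod (a k))) at 2.
  apply Rmult_le_compat_l. apply Cmod_ge_0. rewrite <- (pow1 k). apply pow_incr. split; auto. apply Cmod_ge_0.
Qed.

Definition em_sum (s : C) : C := Csum (fun N => em_term (S N) s).

(** The expansions of the terms and of their sum are produced together, so that the coefficients at
    -1 can be matched index by index. *)
Lemma em_sum_disc_coefs s0 : -1 <= Re s0 ->
  exists a M b m, (forall N, disc_coefs (em_term (S N)) s0 (a N) (M N)) /\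
    (forall k, Cser (fun N => a N k) (b k)) /\ disc_coefs em_sum s0 b m.
Proof.
  intros Hs. destruct (em_term_disc_bd s0 Hs) as [K [HK HE]].
  assert (HE' : forall N, disc_bd (em_term (S N)) s0 (K / INR (S N) ^ 2)) by (intros; apply HE; lia).
  destruct ex_series_inv_sqr as [m Hm].
  assert (HM : is_series (fun N => K / INR (S N) ^ 2) (K * m)).
  { exact (is_series_scal K (fun k => / INR (S k) ^ 2) m Hm). }
  destruct (functional_choice (fun N a => disc_coefs (em_term (S N)) s0 a (K / INR (S N) ^ 2)) HE') as [a Ha].
  destruct (disc_coefs_series (fun N => em_term (S N)) em_sum s0 a _ _ Ha HM) as [b [Hb1 Hb2]].
  - intros w Hw. destruct (Cser_ex_abs (fun N => em_term (S N) (s0 + w)%C) (fun N => K / INR (S N) ^ 2)) as [l Hl].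
    + intros N. now apply disc_bd_Cmod.
    + now exists (K * m).
    + apply (Cser_Csum _ _ Hl).
  - exists a, (fun N => K / INR (S N) ^ 2), b, (K * m). auto.
Qed.

Lemma nat_Cpow_base_1 s : nat_Cpow 1 s = 1.
Proof. unfold nat_Cpow. simpl INR. rewrite ln_1, Cmult_0_r, Cexp_RtoC. now rewrite exp_0. Qed.

Lemma Cmod_nat_Cpow_le m z : (0 < m)%nat -> Re z <= -1 -> Cmod (nat_Cpow m z) <= / INR m.
Proof.
  intros Hm Hz. unfold nat_Cpow. rewrite Cmod_Cexp, re_scal_r.
  assert (HR : 1 <= INR m) by (apply (le_INR 1); lia).
  assert (HL : 0 <= ln (INR m)). { rewrite <- ln_1. destruct HR as [HR|HR]. left; apply ln_increasing; lra. rewrite HR; lra. }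
  rewrite <- (exp_ln (/ INR m)) by (apply Rinv_0_lt_compat; lra). rewrite ln_Rinv by lra.
  assert (Re z * ln (INR m) <= - ln (INR m)) as [H|H] by nra.
  left; now apply exp_increasing. rewrite H; lra.
Qed.

Definition em_start (s : C) : C := (/ 2 * (1 - s) - 1 + / 12 * (s * (1 - s)))%C.

Lemma em_partial_sum s n :
  Csum_n (fun N => em_term (S N) s) n =
  ((1 - s) * Csum_n (fun k => nat_Cpow (S k) (- s)) (S n) - nat_Cpow (S (S n)) (1 - s)
    - / 2 * ((1 - s) * nat_Cpow (S (S n)) (- s))
    + / 12 * (s * (1 - s) * nat_Cpow (S (S n)) (- (1 + s))) - em_start s)%C :> C.
Proof.
  assert (H2 : (/ 2 + / 2)%C = 1) by (field; apply RtoC_neq_0; lra).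
  (* The two trapezoidal halves of an inner term merge into the whole term; the rest telescopes. *)
  assert (H2' : forall x, (/ 2 * x + / 2 * x)%C = x).
  { intros x. replace x with (1 * x)%C at 3 by ring. rewrite <- H2. ring. }
  induction n.
  - rewrite Csum_n_S, !sum_O. unfold em_term, em_start. rewrite !nat_Cpow_base_1.
    rewrite <- (H2' ((1 - s) * (1 + nat_Cpow 2 (- s)))%C). ring.
  - rewrite Csum_n_S, IHn, (Csum_n_S _ (S n)). unfold em_term.
    rewrite <- (H2' ((1 - s) * (Csum_n (fun k => nat_Cpow (S k) (- s)) (S n) + nat_Cpow (S (S (S n))) (- s)))%C).
    rewrite <- (H2' ((1 - s) * (Csum_n (fun k => nat_Cpow (S k) (- s)) (S n)))%C). ring.
Qed.

Lemma is_lim_seq_inv_INR_SS : is_lim_seq (fun n => / INR (S (S n))) 0.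
Proof.
  apply (is_lim_seq_incr_1 (fun n => / INR (S n))). apply (is_lim_seq_incr_1 (fun n => / INR n)).
  replace (Finite 0) with (Rbar_inv p_infty) by reflexivity.
  apply is_lim_seq_inv. apply is_lim_seq_INR. discriminate.
Qed.

(** In the half-plane [Re s > 2] all three boundary powers are at most [1/m] in modulus; [c] gathers
    their coefficients. The identity is used only at the far end of the ray, where this half-plane
    is reached. *)
Lemma em_sum_zeta s Z : 2 < Re s -> Cser (fun n => nat_Cpow (S n) (- s)%C) Z ->
  em_sum s = ((1 - s) * Z - em_start s)%C.
Proof.
  intros Hs HZ. apply Csum_unique. apply Cser_Cmod.
  apply Cser_Cmod in HZ. apply (is_lim_seq_incr_1 (fun n => Cmod (Csum_n (fun n => nat_Cpow (S n) (- s)) n - Z)%C)) in HZ.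
  pose (c := 1 + Cmod (/ 2 * (1 - s))%C + Cmod (/ 12 * (s * (1 - s)))%C).
  apply (is_lim_seq_le_le (fun _ => 0) _ (fun n => Cmod (1 - s)%C * Cmod (Csum_n (fun n => nat_Cpow (S n) (- s)%C) (S n) - Z)%C + c * / INR (S (S n)))).
  - intros n. split. apply Cmod_ge_0. rewrite em_partial_sum.
    set (m := S (S n)). set (P := Csum_n _ (S n)).
    match goal with |- Cmod ?x <= _ => replace x with ((1 - s) * (P - Z) + (-(1) * nat_Cpow m (1 - s)
      + -(1) * ((/ 2 * (1 - s)) * nat_Cpow m (- s)) + (/ 12 * (s * (1 - s))) * nat_Cpow m (- (1 + s))))%C by ring end.
    assert (B1 : Cmod (nat_Cpow m (1 - s)%C) <= / INR m).
    { apply Cmod_nat_Cpow_le. unfold m; lia. unfold Cminus. rewrite re_plus, re_opp, re_RtoC. lra. }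
    assert (B2 : Cmod (nat_Cpow m (- s)%C) <= / INR m).
    { apply Cmod_nat_Cpow_le. unfold m; lia. rewrite re_opp. lra. }
    assert (B3 : Cmod (nat_Cpow m (- (1 + s))%C) <= / INR m).
    { apply Cmod_nat_Cpow_le. unfold m; lia. rewrite re_opp, re_plus, re_RtoC. lra. }
    eapply Rle_trans. apply Cmod_triangle. rewrite Cmod_mult. apply Rplus_le_compat_l.
    eapply Rle_trans. apply Cmod_triangle. eapply Rle_trans. apply Rplus_le_compat_r, Cmod_triangle.
    rewrite (Cmod_mult (-(1))), (Cmod_mult (-(1)) (_ * nat_Cpow m (- s))), Cmod_m1, !Rmult_1_l.
    rewrite (Cmod_mult _ (nat_Cpow m (- s))), (Cmod_mult _ (nat_Cpow m (- (1 + s)))).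
    unfold c. rewrite !Rmult_plus_distr_r, Rmult_1_l.
    pose proof (Rmult_le_compat_l _ _ _ (Cmod_ge_0 (/ 2 * (1 - s))%C) B2).
    pose proof (Rmult_le_compat_l _ _ _ (Cmod_ge_0 (/ 12 * (s * (1 - s)))%C) B3). lra.
  - apply is_lim_seq_const.
  - replace (Finite 0) with (Finite (Cmod (1 - s)%C * 0 + c * 0)) by (f_equal; ring).
    apply is_lim_seq_plus'.
    + apply (is_lim_seq_scal_l _ (Cmod (1 - s)%C) 0). exact HZ.
    + apply (is_lim_seq_scal_l _ c 0). apply is_lim_seq_inv_INR_SS.
Qed.

Lemma has_Cpseries_const (c z : C) r : 0 < r ->
  has_Cpseries (fun _ => c) z (fun k => match k with O => c | S _ => 0 end) r.
Proof.
  intros Hr. split; auto. intros w _. apply Cser_decr_1.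
  replace (c - c * w ^ 0)%C with (0 * Cexp 0)%C by (simpl; ring).
  eapply Cser_ext; [|exact (Cser_scal 0 _ _ (Cser_Cexp 0))]. intros n. simpl. ring.
Qed.

Lemma analytic_at_minus f g z : analytic_at f z -> analytic_at g z -> analytic_at (fun s => f s - g s)%C z.
Proof.
  rewrite !analytic_at_has_Cpseries. intros [a [r H]] [b [r' H']]. eexists _, _. eapply has_Cpseries_minus; eauto.
Qed.

Lemma analytic_at_mul_affine f z p q : analytic_at f z -> analytic_at (fun s => (p + q * s) * f s)%C z.
Proof.
  rewrite !analytic_at_has_Cpseries. intros [a [r H]]. eexists _, _. eapply has_Cpseries_mul_affine; eauto.
Qed.

Lemma analytic_at_const c z : analytic_at (fun _ => c) z.
Proof. apply analytic_at_has_Cpseries. eexists _, 1. apply has_Cpseries_const. lra. Qed.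

(* [(1 - s) zeta s - em_start s - em_sum s], written as nested products with
   affine factors and constants so that its power series can be read off. *)
Definition em_defect (zeta : C -> C) (s : C) : C :=
  ((1 + -(1) * s) * (zeta s - (/ 2 + / 12 * s) * 1) - -(1) - em_sum s)%C.

Lemma em_defect_coefs (zeta : C -> C) (hzeta : is_riemann_zeta zeta) a r :
  has_Cpseries (em_defect zeta) (-(1))%C a r -> forall k, a k = 0.
Proof.
  destruct hzeta as [Hser Han].
  (* The ray is [(t - 1) + i t]: its imaginary part vanishes only at the start -1, so it misses the
     pole, and [t > 3] means [Re s > 2], the range of [em_sum_zeta]. *)
  apply (analytic_ray_identity _ _ (1 + Ci)%C 3).
  - intros E. apply (f_equal Re) in E. unfold Ci in E. rewrite re_plus in E. simpl in E. lra.
  - intros t Ht. 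
    assert (HRe : Re (- (1) + t * (1 + Ci))%C = t - 1) by (unfold Ci, Re; simpl; ring).
    assert (HIm : Im (- (1) + t * (1 + Ci))%C = t) by (unfold Ci, Im; simpl; ring).
    unfold em_defect. apply analytic_at_minus; [apply analytic_at_minus; [apply analytic_at_mul_affine, analytic_at_minus|]|].
    + apply Han. intros E. rewrite E in HRe, HIm. simpl in *. lra.
    + apply analytic_at_mul_affine, analytic_at_const.
    + apply analytic_at_const.
    + destruct (em_sum_disc_coefs (- (1) + t * (1 + Ci))%C) as (a' & M & b & m & _ & _ & H).
      rewrite HRe. lra. apply analytic_at_has_Cpseries. exists b, 1. eapply disc_coefs_has_Cpseries; eauto.
  - intros t Ht.
    assert (HRe : Re (- (1) + t * (1 + Ci))%C = t - 1) by (unfold Ci, Re; simpl; ring).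
    unfold em_defect. set (s := (- (1) + t * (1 + Ci))%C) in *.
    rewrite (em_sum_zeta s (zeta s)). unfold em_start. ring. lra. apply Hser. lra.
Qed.

Lemma nat_Cpow_RtoC n x : nat_Cpow n (RtoC x) = RtoC (exp (x * ln (INR n))).
Proof. unfold nat_Cpow. now rewrite <- RtoC_mult, Cexp_RtoC. Qed.

(** * The derivative at -1 *)

(* [em_term n (-1 + t)] for real [t], with [A = ln (n + 1)] and [B = ln n]. *)
Definition em_real (A B t : R) : R :=
  / 2 * ((2 - t) * (exp ((1 - t) * A) + exp ((1 - t) * B)))
  - (exp ((2 - t) * A) - exp ((2 - t) * B))
  + / 12 * ((-1 + t) * (2 - t) * (exp (- t * A) - exp (- t * B))).

Lemma em_term_real n t : em_term n (-(1) + RtoC t)%C = RtoC (em_real (ln (INR (S n))) (ln (INR n)) t).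
Proof.
  unfold em_term, em_real.
  replace (- (- (1) + RtoC t))%C with (RtoC (1 - t)) by (rewrite RtoC_minus; ring).
  replace (1 - (- (1) + RtoC t))%C with (RtoC (2 - t)) by (rewrite RtoC_minus; ring).
  replace (- (1 + (- (1) + RtoC t)))%C with (RtoC (- t)) by (rewrite RtoC_opp; ring).
  rewrite !nat_Cpow_RtoC.
  repeat (rewrite ?RtoC_plus, ?RtoC_minus, ?RtoC_mult, ?RtoC_opp).
  rewrite !RtoC_inv by lra. change (-1) with (- (1)). rewrite ?RtoC_opp. ring.
Qed.

(** The derivative of [em_term n] at -1, with [m = n + 1] already used to write [-(m + n)/2] as
    [-n - 1/2]. *)
Definition em_deriv (n : nat) : R :=
  let m := INR (S n) in let n' := INR n in let A := ln m in let B := ln n' in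
  - n' - / 2 - m * A - n' * B + m ^ 2 * A - n' ^ 2 * B + (A - B) / 6.

Lemma is_derive_em_real n : (0 < n)%nat ->
  is_derive (em_real (ln (INR (S n))) (ln (INR n))) 0 (em_deriv n).
Proof.
  intros Hn. assert (HR : 0 < INR n) by now apply lt_0_INR.
  assert (HS : 0 < INR (S n)) by (apply lt_0_INR; lia).
  unfold em_deriv. pose proof (S_INR n) as E. revert HS E. generalize (INR (S n)) (INR n) HR.
  clear. intros m p Hp Hm E. cbv zeta.
  replace (- p - / 2) with (- (m + p) / 2) by (rewrite E; field). clear E.
  unfold em_real. auto_derive; auto.
  replace ((1 + - 0) * ln m) with (ln m) by ring.
  replace ((1 + - 0) * ln p) with (ln p) by ring.
  replace ((2 + - 0) * ln m) with (ln m + ln m) by ring.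
  replace ((2 + - 0) * ln p) with (ln p + ln p) by ring.
  replace (- 0 * ln m) with 0 by ring. replace (- 0 * ln p) with 0 by ring.
  rewrite !exp_plus, !exp_ln, exp_0 by auto. field.
Qed.

(** When the function is real along the real direction, its first coefficient is computed by real
    differentiation: the quadratic remainder forces [a 1] and the difference quotient of [phi] to
    agree in the limit. *)
Lemma disc_coefs_coef1_real f s0 a M (phi : R -> R) d :
  disc_coefs f s0 a M -> (forall t, f (s0 + RtoC t)%C = RtoC (phi t)) -> is_derive phi 0 d -> a 1%nat = RtoC d.
Proof.
  intros [_ H] Hphi Hd. 
  assert (H1 : RtoC 1 <> 0) by (apply RtoC_neq_0; lra).
  destruct (Cpseries_remainder2 a 1 (f (s0 + 1)%C) H1) as [B [HB0 HB]].
  { apply H. rewrite Cmod_1; lra. }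
  rewrite Cmod_1 in HB.
  assert (E0 : RtoC (phi 0) = a O).
  { rewrite <- Hphi. apply Cpseries_at_0. apply H. rewrite Cmod_0; lra. }
  apply is_derive_Reals in Hd.
  apply Ceq_minus, Cmod_eq_0. apply Rle_antisym; [|apply Cmod_ge_0].
  apply le_epsilon. intros eps Heps.
  assert (He2 : 0 < eps / 2) by lra.
  destruct (Hd (eps / 2) He2) as [del Hdel].
  (* The three bounds serve the difference quotient, the half-disc of the remainder estimate, and
     [B * t <= eps / 2]. *)
  set (t := Rmin (del / 2) (Rmin (/ 2) (eps / (2 * (B + 1))))).
  assert (0 < eps / (2 * (B + 1))) by (apply Rdiv_lt_0_compat; lra).
  pose proof (cond_pos del).
  assert (Ht : 0 < t) by (unfold t; repeat apply Rmin_glb_lt; lra).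
  assert (Ht1 : t <= del / 2) by apply Rmin_l.
  assert (Ht2 : t <= / 2) by (eapply Rle_trans; [apply Rmin_r | apply Rmin_l]).
  assert (Ht3 : t <= eps / (2 * (B + 1))) by (eapply Rle_trans; [apply Rmin_r | apply Rmin_r]).
  assert (Hdt : Rabs ((phi (0 + t) - phi 0) / t - d) < eps / 2).
  { apply Hdel. lra. rewrite Rabs_pos_eq; lra. }
  rewrite Rplus_0_l in Hdt.
  assert (HBt : Cmod (RtoC (phi t) - a O - a 1%nat * RtoC t)%C <= B * Cmod (RtoC t) ^ 2).
  { apply HB. rewrite Cmod_RtoC_pos; lra. rewrite <- Hphi. apply H. rewrite Cmod_RtoC_pos; lra. }
  rewrite (Cmod_RtoC_pos t) in HBt by lra. rewrite <- E0 in HBt.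
  assert (Ht0 : RtoC t <> 0) by (apply RtoC_neq_0; lra).
  replace (a 1%nat - d)%C with (- ((RtoC (phi t) - RtoC (phi 0) - a 1%nat * RtoC t) / RtoC t) + RtoC ((phi t - phi 0) / t - d))%C.
  2:{ rewrite RtoC_minus, RtoC_div, RtoC_minus by lra. field. auto. }
  eapply Rle_trans. apply Cmod_triangle. rewrite Cmod_opp, Cmod_div, (Cmod_RtoC_pos t), Cmod_R by (auto; lra).
  assert (Cmod (RtoC (phi t) - RtoC (phi 0) - a 1%nat * RtoC t)%C / t <= B * t).
  { apply (Rmult_le_reg_r t); auto. unfold Rdiv. rewrite Rmult_assoc, Rinv_l by lra. lra. }
  assert (B * t <= eps / 2).
  { apply Rle_trans with ((B + 1) * (eps / (2 * (B + 1)))). nra. right. field. lra. }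
  lra.
Qed.

(** The coefficients [al] of [zeta] and [b] of [em_sum] at -1 satisfy two linear equations. With
    [b 0 = 0] the first gives [zeta(-1) = -1/12]; the second then reads [b 1 = 2 zeta'(-1) + 1/3],
    where [zeta'(-1) = 1/12 - ln A]. *)
Lemma ln_glaisher_series (zeta : C -> C) (hzeta : is_riemann_zeta zeta) (A : R) (hA : is_glaisher_kinkelin zeta A) :
  is_series (fun N => em_deriv (S N)) (/ 2 - 2 * ln A).
Proof.
  assert (E1 : (- (1))%C = RtoC (-1)) by (rewrite <- RtoC_opp; f_equal; lra).
  destruct (proj1 (analytic_at_has_Cpseries _ _) (proj2 hzeta (RtoC (-1)) ltac:(intros E; apply RtoC_inj in E; lra))) as [al [r Hal]].
  pose proof (is_C_derive_unique _ _ _ (has_Cpseries_is_derive _ _ _ _ Hal)) as Hd.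
  destruct hA as [_ hA]. rewrite Hd in hA.
  rewrite <- E1 in Hal.
  destruct (em_sum_disc_coefs (-(1))%C) as (a & M & b & m & Ha & Hb & Hh).
  { rewrite re_opp, re_RtoC. lra. }
  pose proof (has_Cpseries_minus _ _ _ _ _ _ _
    (has_Cpseries_minus _ _ _ _ _ _ _
      (has_Cpseries_mul_affine _ _ _ _ 1 (-(1)) (has_Cpseries_minus _ _ _ _ _ _ _ Hal
         (has_Cpseries_mul_affine _ _ _ _ (/2) (/12) (has_Cpseries_const 1 (-(1)) 1 Rlt_0_1))))
      (has_Cpseries_const (-(1)) (-(1)) 1 Rlt_0_1))
    (disc_coefs_has_Cpseries _ _ _ _ Hh)) as Hdef.
  pose proof (em_defect_coefs zeta hzeta _ _ Hdef) as Hz.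
  pose proof (Hz 0%nat) as Z0. pose proof (Hz 1%nat) as Z1. cbv beta iota in Z0, Z1.
  assert (HaN1 : forall N, a N 1%nat = RtoC (em_deriv (S N))).
  { intros N. apply (disc_coefs_coef1_real _ _ _ _ _ _ (Ha N) (em_term_real (S N))). apply is_derive_em_real. lia. }
  (* At [s = -1] the trapezoidal rule is exact: the term is [(m + n) - (m^2 - n^2)] with
     [m = n + 1], and the [B_2] correction has equal end values. *)
  assert (HaN0 : forall N, a N 0%nat = 0).
  { intros N. rewrite <- (has_Cpseries_at_center _ _ _ _ (disc_coefs_has_Cpseries _ _ _ _ (Ha N))).
    replace (-(1))%C with (-(1) + RtoC 0)%C by ring. rewrite em_term_real. f_equal.
    assert (HR : 0 < INR (S N)) by (apply lt_0_INR; lia).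
    assert (HS : 0 < INR (S (S N))) by (apply lt_0_INR; lia).
    unfold em_real. rewrite !Rminus_0_r, Ropp_0, !Rmult_0_l, !exp_0, !Rmult_1_l.
    replace (2 * ln (INR (S (S N)))) with (ln (INR (S (S N))) + ln (INR (S (S N)))) by ring.
    replace (2 * ln (INR (S N))) with (ln (INR (S N)) + ln (INR (S N))) by ring.
    rewrite !exp_plus, !exp_ln by auto. rewrite (S_INR (S N)). field. }
  assert (Hb0 : b 0%nat = 0).
  { apply (Cser_unique _ _ _ (Hb 0%nat)). replace (RtoC 0) with (0 * b 0%nat)%C by ring.
    eapply Cser_ext; [|exact (Cser_scal 0 _ _ (Hb 0%nat))]. intros n. simpl. rewrite HaN0. ring. }
  apply Cser_RtoC.
  replace (RtoC (/ 2 - 2 * ln A)) with (b 1%nat).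
  { eapply Cser_ext; [|exact (Hb 1%nat)]. intros n. apply HaN1. }
  rewrite RtoC_minus, RtoC_mult, hA, RtoC_div, RtoC_inv by lra.
  rewrite Hb0 in Z0.
  assert (N2 : RtoC 2 <> 0) by (apply RtoC_neq_0; lra).
  assert (N12 : RtoC 12 <> 0) by (apply RtoC_neq_0; lra).
  assert (A0 : al 0%nat = (- / 12)%C).
  { match type of Z0 with ?l = _ => assert (X : (al 0%nat + / 12)%C = (/ 2 * l)%C) by (field; auto) end.
    rewrite Z0 in X. replace (al 0%nat) with ((al 0%nat + / 12) - / 12)%C by ring. rewrite X. ring. }
  rewrite A0 in Z1.
  match type of Z1 with ?l = _ => replace (b 1%nat) with (b 1%nat + l)%C by (rewrite Z1; ring) end.
  field; auto.
Qed.

(** * The series of the statement *)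

Lemma is_series_tail (a : nat -> R) (l : R) : is_series a l -> is_series (fun k => a (S k)) (l - a O).
Proof.
  intros H. apply is_series_incr_1.
  change (is_series a (l - a O + a O)). now replace (l - a O + a O) with l by ring.
Qed.

(** Termwise integration of the geometric series from 0 to [x]. *)
Lemma is_series_ln_pow x : 0 <= x < 1 -> is_series (fun k => x ^ S k / INR (S k)) (- ln (1 - x)).
Proof.
  intros Hx.
  assert (HCV : CV_radius (fun _ => 1) = 1).
  { rewrite (CV_radius_finite_DAlembert _ 1). f_equal; apply Rinv_1. intros; lra. lra.
    apply (is_lim_seq_ext (fun _ => 1)). intros; rewrite Rdiv_1_r, Rabs_R1; reflexivity. apply is_lim_seq_const. }
  assert (Hr : Rbar_lt (Rabs x) (CV_radius (fun _ => 1))) by (rewrite HCV; simpl; rewrite Rabs_pos_eq; lra).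
  pose proof (is_pseries_RInt _ _ Hr) as H. apply is_pseries_R in H.
  assert (E : RInt (PSeries (fun _ => 1)) 0 x = - ln (1 - x)).
  { apply is_RInt_unique. 
    apply (is_RInt_ext (fun t => / (1 - t))).
    { intros t Ht. rewrite Rmin_left, Rmax_right in Ht by lra. symmetry. apply is_pseries_unique, is_pseries_R.
      eapply is_series_ext; [| apply is_series_geom; rewrite Rabs_pos_eq; lra]. intros n; simpl; ring. }
    replace (- ln (1 - x)) with (minus (- ln (1 - x)) (- ln (1 - 0))).
    2:{ unfold minus, plus, opp; simpl. rewrite Rminus_0_r, ln_1. ring. }
    apply (is_RInt_derive (fun t => - ln (1 - t))).
    - intros t Ht. rewrite Rmin_left, Rmax_right in Ht by lra. auto_derive. lra. field. lra.
    - intros t Ht. rewrite Rmin_left, Rmax_right in Ht by lra.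
      apply (ex_derive_continuous (fun t => / (1 - t))). auto_derive. lra. }
  rewrite E in H. apply is_series_tail in H. rewrite pow_O in H. simpl PS_Int in H. rewrite Rmult_0_l, Rminus_0_r in H.
  eapply is_series_ext; [|exact H]. intros n. unfold PS_Int, Rdiv. rewrite Rmult_1_l. apply Rmult_comm.
Qed.

Definition gk_coef (k : nat) : R := 28 + 3 / (1 + INR k) - 6 / (2 + INR k).

(** The closed form of the sum over [k >= 1] of [n^(-(2k+1)) gk_coef k]; its logarithms combine to
    [- ln (1 - 1/n^2)]. *)
Definition gk_term (n : R) : R :=
  28 / (n * (n ^ 2 - 1)) + (3 * n - 6 * n ^ 3) * (2 * ln n - ln (n - 1) - ln (n + 1)) + 6 * n.

Lemma gk_coef_pos k : 0 <= gk_coef k.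
Proof.
  unfold gk_coef. pose proof (pos_INR k).
  assert (0 < / (1 + INR k)) by (apply Rinv_0_lt_compat; lra).
  assert (/ (2 + INR k) <= / 2) by (apply Rinv_le_contravar; lra). unfold Rdiv. lra.
Qed.

(** With [x = 1/n^2], the weight 28 gives a geometric series, while the denominators [1 + k] and
    [2 + k] give the logarithmic series without its first one or two terms, divided by [x] and
    [x^2]. *)
Lemma is_series_gk_term n : 2 <= n -> is_series (fun k => / n ^ (2 * S k + 1) * gk_coef (S k)) (gk_term n).
Proof.
  intros Hn. set (x := / n ^ 2).
  assert (Hn2 : 4 <= n ^ 2) by nra.
  assert (Hx : 0 < x < 1).
  { unfold x. split. apply Rinv_0_lt_compat; lra. rewrite <- Rinv_1. apply Rinv_lt_contravar; lra. }
  assert (Hx' : 0 <= x < 1) by lra.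
  pose proof (is_series_ln_pow x Hx') as H.
  assert (HL : - ln (1 - x) = 2 * ln n - ln (n - 1) - ln (n + 1)).
  { replace (1 - x) with ((n - 1) * (n + 1) / (n * n)) by (unfold x; field; lra).
    rewrite ln_div, !ln_mult by nra. ring. }
  rewrite HL in H. set (L := 2 * ln n - ln (n - 1) - ln (n + 1)) in *.
  pose proof (is_series_tail _ _ H) as H2. pose proof (is_series_tail _ _ H2) as H3. cbv beta in H2, H3.
  replace (L - x ^ 1 / INR 1) with (L - x) in H2, H3 by (simpl; field).
  replace (L - x - x ^ 2 / INR 2) with (L - x - x ^ 2 / 2) in H3 by (simpl; field).
  assert (H0 : is_series (fun k => x ^ k) (/ (1 - x))) by (apply is_series_geom; rewrite Rabs_pos_eq; lra).
  apply (is_series_scal (28 * x / n)) in H0. apply (is_series_scal (3 / (x * n))) in H2. apply (is_series_scal (- 6 / (x ^ 2 * n))) in H3.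
  pose proof (is_series_plus _ _ _ _ (is_series_plus _ _ _ _ H0 H2) H3) as HH.
  replace (gk_term n) with (28 * x / n * / (1 - x) + 3 / (x * n) * (L - x) + - 6 / (x ^ 2 * n) * (L - x - x ^ 2 / 2)).
  - eapply is_series_ext; [|exact HH]. intros k. unfold plus, scal; simpl AbelianMonoid.plus; unfold mult; simpl Ring.mult.
    change (28 * x / n * x ^ k + 3 / (x * n) * (x ^ S (S k) / INR (S (S k))) + - 6 / (x ^ 2 * n) * (x ^ S (S (S k)) / INR (S (S (S k)))) = / n ^ (2 * S k + 1) * gk_coef (S k)).
    replace (/ n ^ (2 * S k + 1)) with (x ^ S k / n).
    2:{ unfold x. rewrite pow_add, pow_mult, pow_1, pow_inv. field. split. lra. apply pow_nonzero. lra. }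
    unfold gk_coef. rewrite !S_INR. pose proof (pos_INR k). simpl pow. field. repeat split; lra.
  - unfold gk_term. fold L. replace (28 * x / n * / (1 - x)) with (28 / (n * (n ^ 2 - 1))) by (unfold x; field; repeat split; nra).
    unfold x. field. repeat split; nra.
Qed.

(** The differences with the two polynomials have derivatives [t^4 / (1 + t)] and [t^3 / (1 + t)].
    The orders fit the factor [6 N^3] of the boundary term: powers up to [x^3] affect its limit, and
    [x^4] contributes [O(1/N)]. *)
Lemma ln_1p_bounds x : 0 <= x -> x - x ^ 2 / 2 + x ^ 3 / 3 - x ^ 4 / 4 <= ln (1 + x) <= x - x ^ 2 / 2 + x ^ 3 / 3.
Proof.
  intros Hx. destruct (Req_dec x 0) as [->|Hx0].
  { rewrite Rplus_0_r, ln_1. split; lra. }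
  split.
  - destruct (MVT_gen (fun t => ln (1 + t) - (t - t ^ 2 / 2 + t ^ 3 / 3 - t ^ 4 / 4)) 0 x (fun t => t ^ 4 / (1 + t))) as [c [Hc E]].
    + intros t Ht. rewrite Rmin_left in Ht by lra. auto_derive. lra. field. lra.
    + intros t Ht. rewrite Rmin_left in Ht by lra. apply continuity_pt_filterlim.
      apply (ex_derive_continuous (fun t => ln (1 + t) - (t - t ^ 2 / 2 + t ^ 3 / 3 - t ^ 4 / 4))). auto_derive. lra.
    + rewrite Rmin_left in Hc by lra. rewrite Rplus_0_r, ln_1 in E.
      assert (0 <= c ^ 4 / (1 + c) * (x - 0)).
      { apply Rmult_le_pos; [|lra]. apply Rmult_le_pos. apply pow_le; lra. left; apply Rinv_0_lt_compat; lra. }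
      lra.
  - destruct (MVT_gen (fun t => (t - t ^ 2 / 2 + t ^ 3 / 3) - ln (1 + t)) 0 x (fun t => t ^ 3 / (1 + t))) as [c [Hc E]].
    + intros t Ht. rewrite Rmin_left in Ht by lra. auto_derive. lra. field. lra.
    + intros t Ht. rewrite Rmin_left in Ht by lra. apply continuity_pt_filterlim.
      apply (ex_derive_continuous (fun t => (t - t ^ 2 / 2 + t ^ 3 / 3) - ln (1 + t))). auto_derive. lra.
    + rewrite Rmin_left in Hc by lra. rewrite Rplus_0_r, ln_1 in E.
      assert (0 <= c ^ 3 / (1 + c) * (x - 0)).
      { apply Rmult_le_pos; [|lra]. apply Rmult_le_pos. apply pow_le; lra. left; apply Rinv_0_lt_compat; lra. }
      lra.
Qed.

(* Second differences of [n^3] turn [- 6 n^3 (2 ln n - ln (n-1) - ln (n+1))] into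
   [36 n ln n] up to boundary terms, which is what [-18 em_deriv] contributes. *)
Lemma gk_partial_sum K :
  let N := INR (S (S K)) in
  sum_n (fun k => gk_term (INR (S (S k)))) K =
  - 18 * sum_n (fun k => em_deriv (S k)) K
  + (10 - 14 / (N * (N + 1)) - 3 * ln 2 - 6 * N ^ 2 + 3 * N + (6 * N ^ 3 - 3 * N) * (ln (N + 1) - ln N)) :> R.
Proof.
  induction K as [|K IH]; intros N.
  - rewrite !sum_O. unfold N, gk_term, em_deriv. simpl INR. replace (1 + 1 - 1) with 1 by ring. rewrite ln_1.
    replace (1 + 1) with 2 by ring. field.
  (* What remains is a rational identity in [p] and the logarithms of [p], [p + 1], [p + 2]. The
     part [28 / (n (n^2 - 1))] alone telescopes to [7 - 14 / (N (N + 1))]. *)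
  - rewrite !Rsum_n_S, IH. unfold gk_term, em_deriv. unfold N. rewrite (S_INR (S (S K))).
    replace (INR (S (S K)) + 1 - 1) with (INR (S (S K))) by ring.
    assert (0 < INR (S (S K))) by (apply lt_0_INR; lia). generalize (INR (S (S K))) H.
    intros p Hp. clear -Hp. field. repeat split; nra.
Qed.

(** Here [(6 N^3 - 3 N) ln (1 + 1/N) = 6 N^2 - 3 N - 1 + O(1/N)], so the polynomial parts cancel and
    [10 - 1 = 9] remains. The constants -20 and 2 are generous bounds for the [O(1/N)] terms. *)
Lemma gk_boundary_lim :
  is_lim_seq (fun n => let N := INR (S (S n)) in
    10 - 14 / (N * (N + 1)) - 3 * ln 2 - 6 * N ^ 2 + 3 * N + (6 * N ^ 3 - 3 * N) * (ln (N + 1) - ln N)) (9 - 3 * ln 2).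
Proof.
  apply (is_lim_seq_le_le (fun n => 9 - 3 * ln 2 + (- 20) * / INR (S (S n))) _ (fun n => 9 - 3 * ln 2 + 2 * / INR (S (S n)))).
  - intros n. cbv zeta. set (N := INR (S (S n))).
    assert (HN : 2 <= N) by (unfold N; apply (le_INR 2); lia).
    set (x := / N).
    assert (Hx : 0 < x) by (apply Rinv_0_lt_compat; lra).
    assert (Hx2 : x <= / 2) by (apply Rinv_le_contravar; lra).
    assert (HNx : N * x = 1) by (unfold x; field; lra).
    replace (ln (N + 1) - ln N) with (ln (1 + x)).
    2:{ rewrite <- ln_div by lra. f_equal. unfold x. field. lra. }
    destruct (ln_1p_bounds x) as [B1 B2]. lra.
    assert (HP : 0 <= 6 * N ^ 3 - 3 * N) by nra.
    pose proof (Rmult_le_compat_l _ _ _ HP B1) as C1. pose proof (Rmult_le_compat_l _ _ _ HP B2) as C2.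
    replace ((6 * N ^ 3 - 3 * N) * (x - x ^ 2 / 2 + x ^ 3 / 3 - x ^ 4 / 4)) 
      with (6 * N ^ 2 - 3 * N - 1 - x ^ 2 + 3 / 4 * x ^ 3) in C1 by (unfold x; field; lra).
    replace ((6 * N ^ 3 - 3 * N) * (x - x ^ 2 / 2 + x ^ 3 / 3))
      with (6 * N ^ 2 - 3 * N - 1 + 3 / 2 * x - x ^ 2) in C2 by (unfold x; field; lra).
    assert (0 <= 14 / (N * (N + 1)) <= 14 * x).
    { split. apply Rmult_le_pos. lra. left. apply Rinv_0_lt_compat. nra.
      unfold Rdiv. apply Rmult_le_compat_l. lra. unfold x. apply Rinv_le_contravar. lra. nra. }
    split; nra.
  - replace (Finite (9 - 3 * ln 2)) with (Finite (9 - 3 * ln 2 + -20 * 0)) by (f_equal; ring).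
    apply is_lim_seq_plus'. apply is_lim_seq_const. apply (is_lim_seq_scal_l _ (-20) 0). apply is_lim_seq_inv_INR_SS.
  - replace (Finite (9 - 3 * ln 2)) with (Finite (9 - 3 * ln 2 + 2 * 0)) by (f_equal; ring).
    apply is_lim_seq_plus'. apply is_lim_seq_const. apply (is_lim_seq_scal_l _ 2 0). apply is_lim_seq_inv_INR_SS.
Qed.

Lemma is_series_gk_terms (b : R) :
  is_series (fun N => em_deriv (S N)) b -> is_series (fun k => gk_term (INR (S (S k)))) (9 - 18 * b - 3 * ln 2).
Proof.
  intros H. change (is_lim_seq (sum_n (fun k => gk_term (INR (S (S k))))) (9 - 18 * b - 3 * ln 2)).
  eapply is_lim_seq_ext. intros n. symmetry. apply gk_partial_sum.
  replace (9 - 18 * b - 3 * ln 2) with (-18 * b + (9 - 3 * ln 2)) by ring.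
  apply is_lim_seq_plus'; [|apply gk_boundary_lim].
  apply (is_lim_seq_scal_l _ (-18) b). exact H.
Qed.

Lemma zeta_minus_1_series (zeta : C -> C) (hzeta : is_riemann_zeta zeta) (p : nat) : (1 < p)%nat ->
  Cser (fun N => RtoC (/ INR (S (S N)) ^ p)) (zeta (RtoC (INR p)) - 1)%C.
Proof.
  intros Hp. assert (HP : 1 < INR p) by (apply (lt_INR 1); lia).
  pose proof (proj1 hzeta (RtoC (INR p)) HP) as H.
  apply (Cser_incr_1 (fun n => nat_Cpow (S n) (- RtoC (INR p))%C)) in H. rewrite nat_Cpow_base_1 in H.
  eapply Cser_ext; [|exact H]. intros n. cbv beta.
  rewrite <- RtoC_opp, nat_Cpow_RtoC. f_equal.
  assert (0 < INR (S (S n))) by (apply lt_0_INR; lia).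
  rewrite <- Rpower_pow by auto. unfold Rpower.
  rewrite <- exp_Ropp. f_equal. ring.
Qed.

Theorem mainTheorem7 (zeta : C -> C) (hzeta : is_riemann_zeta zeta)
    (A : R) (hA : is_glaisher_kinkelin zeta A) :
  let term (k : nat) : C :=
    ((zeta (RtoC (INR (2 * k + 1))) - RtoC 1) *
     RtoC (28 + 3 / (1 + INR k) - 6 / (2 + INR k)))%C in
  exists sum : R,
    @is_series C_AbsRing C_NormedModule
      (fun n : nat => term (S n)) (RtoC sum) /\
    ln A = ln 2 / 12 + 1 / 36 * sum.
Proof.
  intros term.
  pose proof (is_series_gk_terms _ (ln_glaisher_series zeta hzeta A hA)) as HS.
  (* This value is [36 ln A - 3 ln 2], left in the form delivered by [is_series_gk_terms]. *)
  exists (9 - 18 * (/ 2 - 2 * ln A) - 3 * ln 2). split; [|field].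
  set (c := fun N k => / INR (S (S N)) ^ (2 * S k + 1) * gk_coef (S k)).
  assert (Hc : forall N k, 0 <= c N k).
  { intros N k. apply Rmult_le_pos. left. apply Rinv_0_lt_compat, pow_lt, lt_0_INR. lia. apply gk_coef_pos. }
  assert (Hrow : forall N, is_series (c N) (gk_term (INR (S (S N))))).
  { intros N. apply is_series_gk_term. apply (le_INR 2). lia. }
  (* The entries are nonnegative, so the row sums [gk_term], whose series converges by [HS], serve
     as their own dominating sequence. *)
  apply (Cser_fubini (fun N k => RtoC (c N k)) (fun N => gk_term (INR (S (S N)))) _ (fun N => RtoC (gk_term (INR (S (S N)))))).
  - intros N K. apply Rle_trans with (sum_n (c N) K).
    apply sum_n_m_le. intros k. rewrite Cmod_RtoC_pos; auto. lra.
    now apply sum_n_le_loc_nonneg.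
  - eexists. exact HS.
  - intros N. now apply Cser_RtoC.
  - intros k. unfold term. rewrite Cmult_comm.
    eapply Cser_ext; [|apply Cser_scal, (zeta_minus_1_series zeta hzeta (2 * S k + 1)); lia].
    intros N. unfold c. rewrite RtoC_mult. apply Cmult_comm.
  - now apply Cser_RtoC.
Qed.
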